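(* Let $n\ge 2$ be an integer. If $\mathcal{F}$ is the class of intersection graphs of families of spheres in $\mathbb{R}^n$, then $n\le\operatorname{asdim}(\mathcal{F})\le n+1$.
   Context: A sphere in $\mathbb{R}^n$ is the boundary of a closed Euclidean ball of positive radius. Families are multisets and may be finite or infinite. The intersection graph of a family $\mathcal{A}$ of sets is the (finite or infinite) simple graph with vertex set $\mathcal{A}$ in which two distinct vertices (members) $S_1,S_2$ are adjacent iff $S_1\cap S_2\neq\emptyset$. A graph $G$ is viewed as an extended metric space (distances may be $+\infty$) $(V(G),\operatorname{dist}_G)$, where $\operatorname{dist}_G(u,v)$ is the infimum of the number of edges of paths between $u$ and $v$. In an extended metric space $(X,d)$: $\operatorname{diam}(U)=\sup_{x,y\in U}d(x,y)$; for $r>0$ a collection $\mathcal{U}$ of subsets is $r$-disjoint if $\inf_{u\in U,u'\in U'}d(u,u')>r$ for all distinct $U,U'\in\mathcal{U}$. For an integer $m\ge 0$, a function $f:\mathbb{R}_+\to\mathbb{R}_+$ is an $m$-dimensional control function for $(X,d)$ if for every positive integer $r$ there is a cover $\mathcal{U}=\bigcup_{i=1}^{m+1}\mathcal{U}_i$ of $X$ with $\operatorname{diam}(U)\le f(r)$ for all $U\in\mathcal{U}$ and each $\mathcal{U}_i$ being $r$-disjoint. A class $\mathcal{G}$ of (finite or infinite) graphs has asymptotic dimension at most $m$ if some single function $f:\mathbb{R}_+\to\mathbb{R}_+$ is an $m$-dimensional control function for all graphs in $\mathcal{G}$; $\operatorname{asdim}(\mathcal{G})$ is the least such integer $m\ge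 0$ ($\infty$ if none exists). *)

(* Defs.v *)
From HB Require Import structures.
From mathcomp Require Import all_boot all_order all_algebra.
From mathcomp Require Import all_classical all_reals all_analysis.

Set Implicit Arguments.
Unset Strict Implicit.
Unset Printing Implicit Defensive.

Import Order.TTheory GRing.Theory Num.Theory.
Import numFieldNormedType.Exports.
Local Open Scope classical_set_scope.
Local Open Scope ring_scope.

(* The canonical norm of 'rV[R]_n is the max norm, so the Euclidean one is
   defined here. The canonical topology of 'rV[R]_n is the product topology,
   which is the Euclidean topology. *)
Definition enorm (R : realType) (n : nat) (x : 'rV[R]_n) : R :=
  Num.sqrt (\sum_(i < n) x ord0 i ^+ 2).

Definition boundary (T : topologicalType) (A : set T) : set T :=
  closure A `\` interior A.

Definition is_sphere (R : realType) (n : nat) (S : set 'rV[R]_n) : Prop :=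
  exists (c : 'rV[R]_n) (r : R),
    0 < r /\ S = boundary (closed_ball_ (@enorm R n) c r).

Record sgraph : Type := SGraph {
  vertex :> Type;
  adj : vertex -> vertex -> Prop;
  adj_sym : forall u v, adj u v -> adj v u;
  adj_irrefl : forall u, ~ adj u u }.

Section IntersectionGraph.
Variables (T I : Type) (A : I -> set T).

Definition meets (i j : I) : Prop := i <> j /\ A i `&` A j !=set0.

Lemma meets_sym i j : meets i j -> meets j i.
Proof. by case=> ij Aij; split; [exact/nesym | rewrite setIC]. Qed.

Lemma meets_irrefl i : ~ meets i i.
Proof. by case. Qed.

(* The multiset of sets is given as an indexed family, and its members are the
   indices: equal sets with distinct indices are distinct vertices. *)
Definition intersection_graph : sgraph := SGraph meets_sym meets_irrefl.

End IntersectionGraph.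

Definition sphere_graphs (R : realType) (n : nat) : set sgraph :=
  [set G | exists (I : Type) (A : I -> set 'rV[R]_n),
     (forall i, is_sphere (A i)) /\ G = intersection_graph A].

(* Only the values p 0, ..., p k are relevant: k counts the edges. *)
Definition is_path (G : sgraph) (u v : G) (k : nat) (p : nat -> G) : Prop :=
  [/\ p 0%N = u, p k = v,
      forall i, (i < k)%N -> adj (p i) (p i.+1) &
      forall i j, (i <= k)%N -> (j <= k)%N -> p i = p j -> i = j].

Definition gdist (R : realType) (G : sgraph) (u v : G) : \bar R :=
  ereal_inf [set k%:R%:E | k in [set k : nat | exists p, is_path u v k p]].

Section ControlFunction.
Variables (R : realType) (X : Type) (d : X -> X -> \bar R).

(* The diameter of the empty set is -oo; a cover may contain the empty set. *)
Definition diam (U : set X) : \bar R :=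
  ereal_sup [set d z.1 z.2 | z in U `*` U].

Definition set_dist (U V : set X) : \bar R :=
  ereal_inf [set d z.1 z.2 | z in U `*` V].

Definition rdisjoint (r : R) (UU : set (set X)) : Prop :=
  forall U V, UU U -> UU V -> U <> V -> (r%:E < set_dist U V)%E.

Definition control_function (m : nat) (f : {nonneg R} -> {nonneg R}) : Prop :=
  forall r : nat, (0 < r)%N ->
  exists UU : 'I_m.+1 -> set (set X),
    [/\ \bigcup_i \bigcup_(U in UU i) U = setT,
        forall i U, UU i U -> (diam U <= (f (r%:R)%:nng)%:num%:E)%E &
        forall i, rdisjoint r%:R (UU i)].

End ControlFunction.

Definition asdim_at_most (R : realType) (GG : set sgraph) (m : nat) : Prop :=
  exists f : {nonneg R} -> {nonneg R},
    forall G, GG G -> control_function (@gdist R G) m f.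

(* An infimum of natural numbers: the least such m, or +oo if there is none. *)
Definition asdim (R : realType) (GG : set sgraph) : \bar R :=
  ereal_inf [set m%:R%:E | m in asdim_at_most R GG].

(* Main.v *)
(* Upper bound. Give each sphere u the size lam(u) of the largest sphere within t
   steps of u, and put u in one of n+1 classes so that u is far, in units of
   lam(u), from the walls of the grid of mesh about lam(u) in the corresponding
   one of n+1 shifted hierarchies of grids. In each class the components of
   {size <= s} form a tree whose bags are covered by boundedly many balls: many
   separated elements of a bag would give many disjoint spheres of radius at
   least lam in a box of comparable side. Graphs with such a coarse tree
   decomposition can be 2-coloured with bounded components, and the n+1 classes
   are merged one after the other, each using one new colour, for a total of n+2
   colours. This is done for finite families; an ultrafilter on the finite
   subfamilies gives the infinite ones.

   Lower bound. In the grid of spheres of radius 1/2 centred at integer points, n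
   colours with bounded components would yield functions f_1, ..., f_n on the
   corners of a large cube, with f_i = 0 on the face x_i = 0, f_i = 1 on the
   opposite face, and f_i constant on the unit cubes of colour i. This contradicts
   a discrete Poincare-Miranda theorem: the cup product of the mod 2 coboundaries
   of the f_i sums to 1 over the cube. *)
Require Import Defs.
From HB Require Import structures.
From mathcomp Require Import all_boot all_order all_algebra.
From mathcomp Require Import all_classical all_reals all_analysis.
From mathcomp Require Import zify ring lra.

Set Implicit Arguments.
Unset Strict Implicit.
Unset Printing Implicit Defensive.

(** * Coarse tree decompositions *)

(** The obstacle is nesting: arbitrarily many pairwise disjoint concentric spheres of nearly equal
    radius fit into one box, so packing alone cannot bound a bag. Connectedness saves the count. The
    elements of a bag are joined by spheres that miss the large ones to be counted, so each large
    sphere has all the others on the same side, and at most one of them contains another. The rest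
    bound disjoint balls, and only boundedly many of these fit into a box.

    All bounds have to be independent of the radii, of the tree and of the size of the finite
    family, or the ultrafilter could not be applied. Hence a bag is measured by the number of balls
    that cover it, not by its cardinality, and distances are always those of the whole graph. The
    number of classes is a pigeonhole: at a given level each of the [n] coordinates of a centre is
    close to a wall of at most one of the shifted grids. *)

Section Connect.
Variables (V : finType) (e : rel V).

Lemma connect_last_ind (P : V -> Prop) (x : V) :
  P x -> (forall y z, connect e x y -> P y -> e y z -> P z) ->
  forall y, connect e x y -> P y.
Proof.
move=> Px Pstep y /connectP[p ep ->]; elim/last_ind: p ep => [|p z IH] //=.
rewrite rcons_path last_rcons => /andP[ep ez].
by apply: (Pstep _ _ _ (IH ep) ez); apply/connectP; exists p.
Qed.

(** Makes any invariant of the vertices reachable from [x] available at both ends of every edge of a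
    walk. *)
Lemma connect_restrict (x y : V) : connect e x y ->
  connect [rel a b | [&& e a b, connect e x a & connect e x b]] x y.
Proof.
move: y; apply: connect_last_ind => // y z xy IH eyz.
apply: (connect_trans IH); apply: connect1 => /=.
by rewrite eyz xy (connect_trans xy (connect1 eyz)).
Qed.

Lemma path_last_split (a : pred V) (x : V) (p : seq V) : a x ->
  exists p1 p2, [/\ p = p1 ++ p2, a (last x p1) & all (predC a) p2].
Proof.
move=> ax; elim/last_ind: p => [|p y [p1 [p2 [-> ap1 ap2]]]].
  by exists [::], [::].
have [ay|nay] := boolP (a y).
  by exists (rcons (p1 ++ p2) y), [::]; rewrite cats0 last_rcons.
by exists p1, (rcons p2 y); rewrite rcons_cat all_rcons /= nay.
Qed.

End Connect.

Lemma connect_mono (V : finType) (e e' : rel V) :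
  (forall x y, e x y -> e' x y) -> forall x y, connect e x y -> connect e' x y.
Proof. by move=> ee' x y; apply: connect_sub => {}x {}y /ee' /connect1. Qed.

(** [nr k] stands for distance at most [k] in the ambient graph. It stays fixed while vertex sets
    and edge relations change along the recursion. *)
Record walk_metric (V : Type) (nr : nat -> V -> V -> Prop) : Prop := {
  wm_refl : forall x, nr 0 x x;
  wm_sym : forall k x y, nr k x y -> nr k y x;
  wm_tri : forall k l x y z, nr k x y -> nr l y z -> nr (k + l) x z;
  wm_le : forall k l x y, k <= l -> nr k x y -> nr l x y }.

Lemma size_filter_neq (T : eqType) (c : T) (s : seq T) : c \in s ->
  size [seq d <- s | d != c] < size s.
Proof.
move=> cs; rewrite size_filter (eq_count (a2 := predC (pred1 c))) //.
have := count_predC (pred1 c) s.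
have : 0 < count (pred1 c) s by rewrite -has_count has_pred1.
move: (size s) (count (pred1 c) s) (count (predC _) s) => *; lia.
Qed.

Section Cover.
Variables (V : finType) (nr : nat -> V -> V -> Prop).
Hypothesis nrP : walk_metric nr.

Lemma connect_cover (e : rel V) (D E : nat) (s : seq V) (x y : V) :
  (forall a b, e a b -> nr D a b) ->
  (forall z, connect e x z -> exists2 c, c \in s & nr E z c) ->
  connect e x y -> nr (size s * (2 * E + D)) x y.
Proof.
move=> eD cov /connectP[p ep ->].
have {}cov : forall z, z \in x :: p -> exists2 c, c \in s & nr E z c.
  move=> z; rewrite inE => /orP[/eqP->|zp]; first exact: cov.
  by apply: cov; apply: (path_connect ep); rewrite inE zp orbT.
have [k] : exists k, k = size s by exists (size s).
move=> kE; rewrite -kE; have {kE} sk : size s <= k by rewrite kE.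
elim: k s sk x p ep cov => [|k IH] s sk x p ep cov.
  by case: s sk cov => // _ /(_ x (mem_head _ _))[].
have [c cs xc] := cov x (mem_head _ _).
have [p1 [p2 [pE p1c p2c]]] : exists p1 p2, [/\ p = p1 ++ p2,
    `[< nr E (last x p1) c >] & all (predC (fun z => `[< nr E z c >])) p2].
  by apply: path_last_split; apply/asboolP.
move/asboolP in p1c; have xz := wm_tri nrP xc (wm_sym nrP p1c).
case: p2 pE p2c => [|z p2] pE p2c.
  rewrite pE cats0; apply: (wm_le nrP _ xz); rewrite mulSn; nia.
move: ep; rewrite pE cat_path /= => /and3P[_ ez ep2].
rewrite last_cat /=.
have zl : nr (k * (2 * E + D)) z (last z p2).
  apply: (IH [seq d <- s | d != c]) => // [|w wp2].
    by rewrite -ltnS; apply: leq_trans sk; apply: size_filter_neq.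
  have [|d ds wd] := cov w; first by rewrite pE inE mem_cat wp2 !orbT.
  exists d => //; rewrite mem_filter ds andbT; apply: contraL wp2 => /eqP dc.
  apply/negP => wp2; move/allP: p2c => /(_ w wp2) /=.
  by rewrite -dc => /asboolP.
apply: (wm_le nrP _ (wm_tri nrP xz (wm_tri nrP (eD _ _ ez) zl))); rewrite mulSn; nia.
Qed.

End Cover.

Definition induced (V : finType) (A : pred V) (H : rel V) : rel V :=
  [rel x y | [&& x \in A, y \in A & H x y]].

Definition mono (V : finType) (K : eqType) (A : pred V) (H : rel V)
    (c : V -> K) : rel V :=
  [rel x y | [&& x \in A, y \in A, c x == c y & H x y]].

Definition ball_reach (V : finType) (nr : nat -> V -> V -> Prop) (A : pred V)
    (H : rel V) (R : nat) (v u : V) : bool :=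
  connect [rel a b | [&& induced A H a b, `[< nr R v a >] & `[< nr R v b >]]]
    v u.

(** Shortcuts for walks that leave [B] briefly. Asking for reachability inside both balls makes the
    relation symmetric. *)
Definition long_edge (V : finType) (nr : nat -> V -> V -> Prop) (A : pred V)
    (H : rel V) (R : nat) (B : pred V) : rel V :=
  [rel v w | [&& v \in B, w \in B, ball_reach nr A H R v w &
                 ball_reach nr A H R w v]].

Lemma connect_invar (V : finType) (e : rel V) (Q : V -> Prop) (x y : V) :
  connect e x y -> Q x -> (forall a b, Q a -> e a b -> Q b) -> Q y.
Proof.
move=> xy Qx Qe; move: y xy; apply: connect_last_ind => // y z _.
exact: Qe.
Qed.

Section Bypass.
Variables (V : finType) (nr : nat -> V -> V -> Prop).
Hypothesis nrP : walk_metric nr.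
Variables (A B : pred V) (H r : rel V) (D M : nat).
Hypotheses (r_sym : symmetric r) (rA : forall a b, r a b -> induced A H a b).
Hypothesis rD : forall a b, r a b -> nr D a b.
Let rT : rel V := [rel a b | [&& a \notin B, b \notin B & r a b]].
Hypothesis short : forall z u y, z \in B -> r z u -> u \notin B ->
  connect rT u y -> nr M u y.

(** Large enough for both ends: an excursion lies within [D + M] of the vertex where it leaves [B]
    and within [D + 2 * M] of the one where it returns, and these two are within [2 * D + M] of each
    other. *)
Let R := 2 * D + 2 * M.

Let excursion z u y a : z \in B -> r z u -> u \notin B ->
  connect rT u y -> connect rT u a -> nr (D + M) z a /\ nr (2 * M) y a.
Proof.
move=> zB zu uB uy ua; split; first exact: wm_tri (rD zu) (short zB zu uB ua).
rewrite mul2n -addnn.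
exact: wm_tri (wm_sym nrP (short zB zu uB uy)) (short zB zu uB ua).
Qed.

(* A step of an excursion outside B is short, so its two ends in B are joined
   by a long edge. *)
Lemma bypass (x y : V) : x \in B -> connect r x y ->
  exists z, [/\ z \in B, connect (long_edge nr A H R B) x z & nr (D + M) z y].
Proof.
move=> xB xy.
suff [z [zB xz zy]] : exists z, [/\ z \in B,
    connect (long_edge nr A H R B) x z &
    y = z \/ exists u, [/\ r z u, u \notin B & connect rT u y]].
  exists z; split=> //; case: zy => [->|[u [zu uB uy]]].
    exact: wm_le (wm_refl nrP z).
  by have [] := excursion zB zu uB uy uy.
move: y xy; apply: connect_last_ind.
  by exists x; split=> //; left.
move=> y y' _ [z [zB xz zy]] yy'.
have [y'B|y'B] := boolP (y' \in B); last first.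
  exists z; split=> //; right; case: zy => [yz|[u [zu uB uy]]].
    by exists y'; rewrite -yz.
  exists u; split=> //; apply: (connect_trans uy); apply: connect1 => /=.
  have yB : y \notin B.
    by apply: (connect_invar (Q := fun a => a \notin B) uy) => // a b _ /and3P[].
  by rewrite /rT /= yB y'B.
exists y'; split=> //; last by left.
apply: (connect_trans xz); apply: connect1; rewrite /long_edge /= zB y'B /=.
have nz a : nr 0 a a := wm_refl nrP a.
case: zy => [yz|[u [zu uB uy]]].
  rewrite -yz; apply/andP; split; apply: connect1 => /=.
    rewrite rA //=; apply/andP; split; apply/asboolP.
      exact: wm_le (nz y).
    by apply: (wm_le nrP _ (rD yy')); clear; lia.
  rewrite rA 1?r_sym //=; apply/andP; split; apply/asboolP.
    exact: wm_le (nz y').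
  by apply: (wm_le nrP _ (wm_sym nrP (rD yy'))); clear; lia.
have ex a : connect rT u a -> nr (D + M) z a /\ nr (2 * M) y a.
  exact: excursion.
have inT := connect_restrict uy.
apply/andP; split.
  apply: (@connect_trans _ _ u).
    apply: connect1; rewrite /= rA //=; apply/andP; split; apply/asboolP.
      exact: wm_le (nz z).
    by apply: (wm_le nrP _ (rD zu)); clear; lia.
  apply: (@connect_trans _ _ y).
    apply: connect_mono inT => a b /= /and3P[/and3P[_ _ /rA ->] ua ub] /=.
    apply/andP; split; apply/asboolP.
      by apply: (wm_le nrP _ (proj1 (ex _ ua))); clear; lia.
    by apply: (wm_le nrP _ (proj1 (ex _ ub))); clear; lia.
  apply: connect1; rewrite /= rA //=; apply/andP; split; apply/asboolP.
    by apply: (wm_le nrP _ (proj1 (ex _ uy))); clear; lia.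
  by apply: (wm_le nrP _ (wm_tri nrP (proj1 (ex _ uy)) (rD yy'))); clear; lia.
have far a : connect rT u a -> nr R y' a.
  move=> ua; apply: (wm_le nrP _ (wm_tri nrP (wm_sym nrP (rD yy'))
    (proj2 (ex _ ua)))); rewrite /R; clear; lia.
apply: (@connect_trans _ _ y).
  apply: connect1; rewrite /= rA 1?r_sym //=; apply/andP; split; apply/asboolP.
    exact: wm_le (nz y').
  exact: far.
apply: (@connect_trans _ _ u).
  have symT : symmetric
      [rel a b | [&& rT a b, connect rT u a & connect rT u b]].
    move=> a b; rewrite /rT /= r_sym (andbCA (a \notin B)).
    by rewrite [connect _ u a && _]andbC.
  move: inT; rewrite (sym_connect_sym symT).
  apply: connect_mono => a b /= /and3P[/and3P[_ _ /rA ->] ua ub] /=.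
  by apply/andP; split; apply/asboolP; apply: far.
apply: connect1; rewrite /= rA 1?r_sym //=; apply/andP; split; apply/asboolP.
  exact: far.
apply: (wm_le nrP _ (wm_tri nrP (wm_sym nrP (rD yy'))
  (wm_sym nrP (proj1 (ex _ uy))))); rewrite /R; clear; lia.
Qed.

End Bypass.

(* The forest is the preorder [le], in which ancestors are larger; [bt v p]
   says that the bag of [p] contains [v], and [pi v] is the highest such [p]. *)
Record tree_dec (V : finType) (nr : nat -> V -> V -> Prop) (P : Type)
    (A : pred V) (H : rel V) (le : rel P) (pi : V -> P) (bt : V -> P -> bool)
    (D : nat) : Prop := {
  td_refl : forall p, le p p;
  td_trans : forall p q r, le p q -> le q r -> le p r;
  td_lin : forall p q r, le p q -> le p r -> le q r \/ le r q;
  td_own : forall v, v \in A -> bt v (pi v);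
  td_up : forall v p, v \in A -> bt v p -> le p (pi v);
  td_conv : forall v p q, v \in A -> bt v p -> le p q -> le q (pi v) -> bt v q;
  td_edge : forall v w, v \in A -> w \in A -> H v w ->
    le (pi v) (pi w) /\ bt w (pi v) \/ le (pi w) (pi v) /\ bt v (pi w);
  td_sym : symmetric H;
  td_nr : forall v w, v \in A -> w \in A -> H v w -> nr D v w }.

Definition width (V : finType) (nr : nat -> V -> V -> Prop) (P : Type)
    (A : pred V) (bt : V -> P -> bool) (D th : nat) : Prop :=
  forall p, exists s : seq V, size s <= th /\
    forall v, v \in A -> bt v p -> exists2 x, x \in s & nr D v x.

Section TreeDec.
Variables (V : finType) (nr : nat -> V -> V -> Prop).
Hypothesis nrP : walk_metric nr.
Variables (P : Type) (le : rel P).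

Lemma tree_dec_sub (A A' : pred V) H pi bt D :
  {subset A' <= A} -> tree_dec nr A H le pi bt D ->
  tree_dec nr A' H le pi bt D.
Proof.
move=> sA [h1 h2 h3 h4 h5 h6 h7 h8 h9]; split => //.
- by move=> v /sA; apply: h4.
- by move=> v p /sA; apply: h5.
- by move=> v p q /sA; apply: h6.
- by move=> v w /sA vA /sA; apply: h7.
- by move=> v w /sA vA /sA; apply: h9.
Qed.

Section Paths.
Variables (A : pred V) (H e : rel V) (pi : V -> P) (bt : V -> P -> bool).
Variable (D : nat).
Hypothesis td : tree_dec nr A H le pi bt D.
Hypothesis eA : forall a b, e a b -> induced A H a b.

(** By [td_edge] and [td_conv], an edge that leads from a top strictly below [q] to a top above [q]
    ends at a vertex whose bags include [q]. A walk without such vertices keeps its tops strictly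
    below [q]. *)
Lemma td_cross u m q : u \in A -> connect e u m -> le (pi u) q ->
  le q (pi m) -> exists u', connect e u u' /\ bt u' q.
Proof.
move=> uA um uq qm.
have [//|nf] := pselect (exists u', connect e u u' /\ bt u' q).
have {}nf u' : connect e u u' -> ~~ bt u' q.
  by move=> uu'; apply/negP => bu'; apply: nf; exists u'.
suff [_] : le (pi m) q /\ ~~ le q (pi m) by rewrite qm.
move: m um {qm}; apply: connect_last_ind.
  split=> //; apply/negP => qu; have := nf u (connect0 _ _); apply/negP/negPn.
  exact: (td_conv td uA (td_own td uA)).
move=> x y ux [xq nqx] exy.
have uy := connect_trans ux (connect1 exy).
have /and3P[xA yA Hxy] := eA exy.
have [[xy bxy]|[yx bxy]] := td_edge td xA yA Hxy.
  have [qy|yq] := td_lin td xq xy.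
    by have := nf _ uy; rewrite (td_conv td yA bxy xq qy).
  split=> //; apply/negP => qy.
  by have := nf _ uy; rewrite (td_conv td yA bxy xq qy).
split; first exact: (td_trans td yx).
by apply: contraNN nqx => qy; apply: (td_trans td qy yx).
Qed.

(** Tops along an edge are comparable, so a walk leaving the down-set of [pi m] reaches a top above
    [pi m]. Choosing the largest down-set excludes this, and needs no antisymmetry. *)
Lemma td_max v : symmetric e -> v \in A ->
  exists m, connect e v m /\ forall u, connect e v u -> le (pi u) (pi m).
Proof.
move=> e_sym vA.
pose N m := #|[pred u | connect e v u && le (pi u) (pi m)]|.
have [m vm maxm] : exists2 m, connect e v m &
    forall u, connect e v u -> N u <= N m.
  by case: (arg_maxnP N (connect0 e v)) => m; exists m.
exists m; split=> // u vu.
have mu : connect e m u.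
  by apply: connect_trans vu; rewrite (sym_connect_sym e_sym).
move: u mu {vu}; apply: connect_last_ind => [|x y mx xm exy].
  exact: (td_refl td).
have /and3P[xA yA Hxy] := eA exy.
have [[xy _]|[yx _]] := td_edge td xA yA Hxy; last exact: (td_trans td yx).
have [//|my] := td_lin td xy xm.
have vy : connect e v y by apply: connect_trans (connect_trans vm mx) (connect1 exy).
apply/negPn/negP => nym.
have := maxm y vy; rewrite leqNgt => /negP; apply.
apply: proper_card; apply/properP; split.
  by apply/fintype.subsetP => z; rewrite !inE => /andP[-> zm]; apply: (td_trans td zm).
by exists y; rewrite inE vy ?(negPf nym) ?andbF //= (td_refl td).
Qed.

End Paths.

Lemma ball_reach_near A H R v u : ball_reach nr A H R v u -> nr R v u.
Proof.
rewrite /ball_reach; move: u; apply: connect_last_ind => [|x y _ _].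
  exact: wm_le (wm_refl nrP v).
by case/and3P=> _ _ /asboolP.
Qed.

(* A ball is replaced by its part that is reachable inside it, and it is hung
   at the highest node of this part. *)
Lemma td_local (A B : pred V) H pi bt D R (T : P -> bool) :
  tree_dec nr A H le pi bt D -> {subset B <= A} ->
  (forall v, v \in B -> T (pi v)) ->
  (forall p q u, T p -> le p q -> u \in A -> le q (pi u) -> T q) ->
  exists pi', tree_dec nr B (long_edge nr A H R B) le pi'
    (fun v q => T q && [exists u, ball_reach nr A H R v u && bt u q]) (D + R).
Proof.
move=> td sBA TB Tup.
pose e v := [rel a b | [&& induced A H a b, `[< nr R v a >] & `[< nr R v b >]]].
have eA v a b : e v a b -> induced A H a b by case/and3P.
have e_sym v : symmetric (e v).
  move=> a b; rewrite /e /induced /= (td_sym td) (andbCA (a \in A)); congr andb.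
  exact: andbC.
have reachA v u : v \in A -> connect (e v) v u -> u \in A.
  by move=> vA; move: u; apply: connect_last_ind => // x y _ _ /eA /and3P[].
have /choice [m mP] v : exists m, v \in A -> connect (e v) v m /\
    forall u, connect (e v) v u -> le (pi u) (pi m).
  case: (boolP (v \in A)) => [vA|]; last by exists v.
  by have [m ?] := td_max td (eA v) (e_sym v) vA; exists m.
have mA v : v \in A -> m v \in A by move=> vA; apply: reachA (proj1 (mP v vA)).
have vm v : v \in A -> le (pi v) (pi (m v)) by move=> vA; apply: (proj2 (mP v vA)).
have TM v q : v \in B -> le (pi v) q -> le q (pi (m v)) -> T q.
  by move=> vB vq; apply: Tup vq _; [exact: TB | exact/mA/sBA].
exists (pi \o m); split=> /=.
- exact: (td_refl td).
- exact: (td_trans td).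
- exact: (td_lin td).
- move=> v vB; have vA := sBA v vB; have [vmv _] := mP v vA.
  rewrite (TM v) ?vm //=; last exact: (td_refl td).
  by apply/existsP; exists (m v); rewrite [ball_reach _ _ _ _ _ _]vmv (td_own td) // mA.
- move=> v p vB /andP[_ /existsP[u /andP[vu bu]]]; have vA := sBA v vB.
  apply: (td_trans td) (proj2 (mP v vA) u vu).
  by apply: (td_up td) bu; apply: reachA vu.
- move=> v p q vB /andP[Tp /existsP[u /andP[vu bu]]] pq qm; have vA := sBA v vB.
  rewrite (Tup _ _ _ Tp pq (mA v vA) qm) /=; have uA := reachA _ _ vA vu.
  have um : connect (e v) u (m v).
    apply: connect_trans (proj1 (mP v vA)).
    by rewrite (sym_connect_sym (e_sym v)).
  have [u' [uu' bu']] : exists u', connect (e v) u u' /\ bt u' q.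
    have [uq|qu] := td_lin td (td_up td uA bu) pq.
      exact: (td_cross td (eA v) uA um uq qm).
    by exists u; split=> //; apply: (td_conv td uA bu).
  by apply/existsP; exists u'; rewrite bu' andbT; apply: connect_trans vu uu'.
- move=> v w vB wB /and4P[_ _ vw wv]; have vA := sBA v vB; have wA := sBA w wB.
  have edge a b : a \in B -> b \in B -> connect (e b) b a ->
      le (pi (m a)) (pi (m b)) -> T (pi (m a)) &&
      [exists u, ball_reach nr A H R b u && bt u (pi (m a))].
    move=> aB bB ba ab; have aA := sBA a aB; have bA := sBA b bB.
    rewrite (TM a) ?vm //=; last exact: (td_refl td).
    have abm : connect (e b) a (m b).
      apply: connect_trans (proj1 (mP b bA)).
      by rewrite (sym_connect_sym (e_sym b)).
    have [u [au bu]] := td_cross td (eA b) aA abm (vm a aA) ab.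
    by apply/existsP; exists u; rewrite bu andbT; apply: connect_trans ba au.
  have vmw := proj2 (mP w wA) v wv.
  have [h|h] := td_lin td (vm v vA) vmw; [left|right]; split=> //.
    exact: edge.
  exact: edge.
- by move=> v w; rewrite /long_edge /=; rewrite andbCA; congr [&& _, _ & _]; rewrite andbC.
- move=> v w _ _ /and4P[_ _ vw _].
  by apply: (wm_le nrP (leq_addl D R)); apply: ball_reach_near vw.
Qed.

Lemma width_local (A B : pred V) H bt D R (T : P -> bool) th :
  width nr A bt D th -> {subset B <= A} -> 
  width nr B
    (fun v q => T q && [exists u, ball_reach nr A H R v u && bt u q]) (D + R) th.
Proof.
move=> wid sBA p; have [s [sth sP]] := wid p; exists s; split=> // v vB.
case/andP=> _ /existsP[u /andP[vu bu]].
have uA : u \in A.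
  have := sBA v vB; move: vu; rewrite /ball_reach => vu vA.
  move: u vu {bu}; apply: connect_last_ind => // x y _ _.
  by case/and3P => /and3P[].
have [x xs ux] := sP u uA bu; exists x => //.
by rewrite addnC; apply: (wm_tri nrP (ball_reach_near vu)).
Qed.

End TreeDec.

Definition bounded_comps (V : finType) (nr : nat -> V -> V -> Prop)
    (e : rel V) (F : nat) : Prop :=
  forall x y, connect e x y -> nr F x y.

Lemma mono_sym (V : finType) (K : eqType) (A : pred V) (H : rel V) (c : V -> K) :
  symmetric H -> symmetric (mono A H c).
Proof. by move=> Hs x y; rewrite /mono /= Hs eq_sym andbCA. Qed.

(** * Two-colouring with bounded components, by induction on the width *)

Section Step.
Variables (V : finType) (nr : nat -> V -> V -> Prop).
Hypothesis nrP : walk_metric nr.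
Variables (P : Type) (le : rel P) (A : pred V) (H : rel V).
Variables (pi : V -> P) (bt : V -> P -> bool) (D th F' : nat).
Hypothesis td : tree_dec nr A H le pi bt D.
Hypothesis wid : width nr A bt D th.+1.

(** The bound of [connect_cover] for a walk within [D] of one bag, hence within [2 * D] of its
    [th.+1] centres. Then [R] is the radius of [bypass] for excursions of length [R0]. *)
Let R0 := th.+1 * (2 * (2 * D) + D).
Let R := 2 * D + 2 * R0.
Hypothesis IHth : forall B H' pi' bt',
  tree_dec nr B H' le pi' bt' (D + R) -> width nr B bt' (D + R) th ->
  exists c : V -> bool, bounded_comps nr (mono B H' c) F'.

(** The radius of a ball plus three steps of length [D]: from a vertex [u] of the ball to the
    dropped centre, on to the touching vertex [b], and from there to the bag of [p]; see
    [far_colouring]. *)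
Let L2 := 3 * D + R.
(** From a far vertex: across its component in the colouring of [far], one edge to medium distance,
    then to a centre of the bag of [p]. *)
Let E2 := F' + D + (L2 + D).
Let Fo := R0 + F' + D + th.+1 * (2 * E2 + D).

Definition down_closed (W : pred V) :=
  {subset W <= A} /\
  forall v w, v \in W -> w \in A -> le (pi w) (pi v) -> w \in W.

(* The second clause lets the colouring of a down-closed set be extended
   upwards: whatever touches the outside has colour [false] and lies in a short
   component. *)
Definition good (W : pred V) (c : V -> bool) :=
  bounded_comps nr (mono W H c) (2 * Fo) /\
  forall x y z, x \in W -> z \in A -> z \notin W -> H x z ->
    connect (mono W H c) x y -> c x = false /\ nr R0 x y.

(* The bag of a maximal node [p] of [W] and everything hanging below it through
   bags that stay close to it form [own]. Vertices of [own] are coloured by their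
   distance to the bag of [p]: [false] near it, [true] at medium distance, and
   far away by induction on the width, since the ball that makes a node touched
   can be dropped from the cover of its bag. *)
Section Phase.
Variables (W : pred V) (v0 : V).
Hypotheses (Wdown : down_closed W) (v0W : v0 \in W).
Let p := pi v0.
Hypothesis v0max : forall w, w \in W -> le p (pi w) -> le (pi w) p.

Let WA : {subset W <= A} := proj1 Wdown.

Let dS (L : nat) (v : V) := [exists s, [&& s \in A, bt s p & `[< nr L v s >]]].
Let touched (q : P) := [exists b, [&& b \in A, bt b q & dS D b]].
Let Tq (q : P) := `[< le q p /\ forall q', le q q' -> le q' p -> touched q' >].
Let own := [pred v | (v \in W) && Tq (pi v)].
Let U := [pred v | (v \in W) && (v \notin own)].

Let dS_le L L' v : L <= L' -> dS L v -> dS L' v.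
Proof.
move=> LL /existsP[s /and3P[sA bs /asboolP vs]]; apply/existsP; exists s.
by rewrite sA bs /=; apply/asboolP; apply: wm_le vs.
Qed.

Let dS_step L k v w : nr k v w -> dS L w -> dS (k + L) v.
Proof.
move=> vw /existsP[s /and3P[sA bs /asboolP ws]]; apply/existsP; exists s.
by rewrite sA bs /=; apply/asboolP; apply: wm_tri ws.
Qed.

Let dS_bag v : v \in A -> bt v p -> dS 0 v.
Proof.
move=> vA bv; apply/existsP; exists v; rewrite vA bv /=; apply/asboolP.
exact: wm_refl.
Qed.

Let centres : exists s : seq V, size s <= th.+1 /\
  forall L v, dS L v -> exists2 x, x \in s & nr (L + D) v x.
Proof.
have [s [sth sP]] := wid p; exists s; split=> // L v.
case/existsP=> u /and3P[uA bu /asboolP vu]; have [x xs ux] := sP u uA bu.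
by exists x => //; apply: wm_tri ux.
Qed.

Let TqW v : v \in W -> le p (pi v) -> Tq (pi v).
Proof.
move=> vW pv; apply/asboolP; split; first exact: v0max.
move=> q vq qp; apply/existsP; exists v0; have v0A := WA v0W.
have bv : bt v0 p by apply: td_own td v0 v0A.
rewrite v0A (td_conv td v0A bv (td_trans td pv vq) qp) /=.
by apply: dS_le (dS_bag v0A bv).
Qed.

Let v0own : v0 \in own.
Proof. by rewrite inE v0W TqW //; apply: td_refl td _. Qed.

Let ownA v : v \in own -> v \in A.
Proof. by case/andP => /WA. Qed.

Let below v w : v \in W -> w \in W -> le (pi v) p -> H v w -> le (pi w) p.
Proof.
move=> vW wW vp Hvw; have [[vw _]|[wv _]] := td_edge td (WA vW) (WA wW) Hvw.
  by have [/(v0max wW)|] := td_lin td vp vw.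
exact: (td_trans td wv).
Qed.

(** As [u] is not in [own], some node [q] between [pi u] and [p] is untouched. The nodes from [pi v]
    up to [p] are touched, so [q] lies below [pi v] and its bag contains [v]; were [v] close to the
    bag of [p], it would touch [q]. *)
Let own_U v u : v \in own -> u \in U -> H v u -> le (pi u) p /\ ~~ dS D v.
Proof.
case/andP=> vW /asboolP[vp vT] /andP[uW nu] Hvu.
have up := below vW uW vp Hvu; split=> //.
have {nu} nTu : ~ Tq (pi u) by move=> Tu; case/negP: nu; rewrite inE uW.
have [q [uq qp nq]] : exists q, [/\ le (pi u) q, le q p & ~ touched q].
  apply: contrapT => nex; apply: nTu; apply/asboolP; split=> // q uq qp.
  by apply: contrapT => nq; apply: nex; exists q.
apply/negP => dv; apply: nq.
have [[vu _]|[uv bv]] := td_edge td (WA vW) (WA uW) Hvu.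
  by apply: vT => //; apply: td_trans td _ _ _ vu uq.
have [vq|qv] := td_lin td uv uq; first exact: vT.
apply/existsP; exists v; rewrite (WA vW) dv andbT /=.
exact: (td_conv td (WA vW) bv uq qv).
Qed.

(** A top of [x] below [p] would put [x] into the down-closed [W]. With [td_conv] it follows that
    [x] is in the bag of [p]. *)
Let above v x : v \in W -> x \in A -> x \notin W -> H v x -> le (pi v) p ->
  [/\ le (pi v) (pi x), le p (pi x) & bt x (pi v)].
Proof.
move=> vW xA xW Hvx vp; have [[vx bx]|[xv bv]] := td_edge td (WA vW) xA Hvx.
  have [px|xp] := td_lin td vp vx; first by split.
  by case/negP: xW; apply: (proj2 Wdown) v0W xA xp.
by case/negP: xW; apply: (proj2 Wdown) vW xA xv.
Qed.

Let own_out v x : v \in own -> x \in A -> x \notin W -> H v x -> dS D v.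
Proof.
case/andP=> vW /asboolP[vp _] xA xW Hvx.
have [vx px bx] := above vW xA xW Hvx vp.
have bxp : bt x p := td_conv td xA bx vp px.
have := dS_step (td_nr td (WA vW) xA Hvx) (dS_bag xA bxp).
by rewrite addn0.
Qed.

(** Otherwise [x] would lie in all bags from [pi v] up to [p] and touch these nodes, so that [v]
    would be in [own]. *)
Let U_out v x : v \in U -> x \in A -> x \notin W -> H v x -> ~~ le (pi v) p.
Proof.
case/andP=> vW nv xA xW Hvx; apply/negP => vp; case/negP: nv.
rewrite inE vW /=; apply/asboolP; split=> // q vq qp.
have [vx px bx] := above vW xA xW Hvx vp.
apply/existsP; exists x; rewrite xA /=; apply/andP; split.
  by apply: td_conv td _ _ _ xA bx vq _; apply: td_trans td _ _ _ qp px.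
by apply: dS_le (dS_bag xA (td_conv td xA bx vp px)).
Qed.

Let U_down : down_closed U.
Proof.
split=> [v /andP[/WA //]|u w /andP[uW nu] wA wu].
rewrite inE (proj2 Wdown _ _ uW wA wu) /=; apply: contra nu => /andP[wW].
move=> /asboolP[wp wT]; have [up|pu] := td_lin td wu wp; last first.
  by rewrite inE uW TqW.
rewrite inE uW; apply/asboolP; split=> // q uq; apply: wT.
exact: td_trans td _ _ _ wu uq.
Qed.

Let A1 := [pred v | (v \in A) && le (pi v) p].
Let far := [pred v | (v \in own) && ~~ dS L2 v].
Let H' := long_edge nr A1 H R far.

Let far_colouring : exists c : V -> bool, bounded_comps nr (mono far H' c) F'.
Proof.
have sA1 : {subset A1 <= A} by move=> v /andP[].
have sfar : {subset far <= A1}.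
  by move=> v /andP[/andP[/WA vA /asboolP[vp _]] _]; rewrite inE vA.
have td1 := tree_dec_sub sA1 td.
have [||pi' td'] := td_local nrP R (T := Tq) td1 sfar.
- by move=> v /andP[/andP[]].
- move=> q q' u /asboolP[qp qT] qq' /andP[_ up] q'u.
  apply/asboolP; split; first exact: td_trans td _ _ _ q'u up.
  by move=> q'' q'q''; apply: qT; apply: td_trans td _ _ _ qq' q'q''.
apply: (IHth td') => q.
have [[qp qT]|nT] := pselect (le q p /\ forall q', le q q' -> le q' p -> touched q'); last first.
  by exists [::]; split=> // v _ /andP[/asboolP].
have /existsP[b /and3P[bA bq db]] := qT q (td_refl td q) qp.
have [s [sth sP]] := wid q.
have [x0 x0s bx0] := sP b bA bq.
exists [seq x <- s | x != x0]; split.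
  by rewrite -ltnS; apply: leq_trans sth; apply: size_filter_neq.
move=> v vfar /andP[_ /existsP[u /andP[vu bu]]].
have uA : u \in A.
  have := sA1 _ (sfar _ vfar); move: vu; rewrite /ball_reach => vu vA.
  move: u vu {bu}; apply: connect_last_ind => // x y _ _.
  by case/and3P => /and3P[_ /sA1].
have vRu := ball_reach_near nrP vu.
have [x xs ux] := sP u uA bu; exists x.
  rewrite mem_filter xs andbT; apply: contraTneq vfar => xx0; rewrite inE.
  rewrite xx0 in ux; rewrite negb_and negbK; apply/orP; right.
  apply: dS_le (dS_step (wm_tri nrP vRu (wm_tri nrP ux (wm_sym nrP bx0))) db).
  by rewrite /L2; clear; lia.
by rewrite addnC; apply: wm_tri ux.
Qed.

Hypothesis IHW : forall W', down_closed W' -> #|W'| < #|W| ->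
  exists c, good W' c.

Lemma phase : exists c, good W c.
Proof.
have [|cU [cU1 cU2]] := IHW U_down.
  apply: proper_card; apply/properP; split.
    by apply/fintype.subsetP => v /andP[].
  by exists v0 => //; rewrite inE v0W v0own.
have [cf cfP] := far_colouring.
have [s [sth sP]] := centres.
pose c v := if v \in own then if dS D v then false else
  if dS L2 v then true else cf v else cU v.
exists c.
have Hs := td_sym td.
have ms := mono_sym W c Hs.
have cown v : v \in own -> c v = if dS D v then false else
  if dS L2 v then true else cf v by rewrite /c => ->.
have cUE v : v \in U -> c v = cU v.
  by rewrite /c => /andP[_ /negPf ->].
have ownU v : v \in W -> (v \in own) || (v \in U).
  by rewrite [v \in U]inE => ->; case: (v \in own).
(* The second clause of [good] for [U], with [v] as the outside vertex. *)
have UF u v : u \in U -> v \in own -> H v u -> c u = false /\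
    forall y, connect (mono U H cU) u y -> nr R0 u y.
  move=> uU vown Hvu; rewrite cUE //.
  have vU : v \notin U by rewrite inE vown andbF.
  split; first by case: (cU2 u u v) => //; rewrite ?ownA // Hs.
  by move=> y uy; case: (cU2 u y v) => //; rewrite ?ownA // Hs.
(* Neighbours in [own] of a vertex within [D] of the bag are within [2 * D], at most [L2], so they
   are coloured [true] unless they are within [D] again; [own_U] excludes neighbours in [U]. *)
have inner x y : x \in own -> dS D x -> connect (mono W H c) x y -> nr R0 x y.
  move=> xo dx xy.
  have in_inner z : connect (mono W H c) x z -> (z \in own) && dS D z.
    move: z; apply: connect_last_ind; first by rewrite xo.
    move=> a b _ /andP[ao da] /and4P[aW bW /eqP cab Hab].
    have /orP[bo|bU] := ownU b bW; last first.
      by have [_] := own_U ao bU Hab; rewrite da.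
    rewrite bo; move: cab; rewrite !cown // da; case: ifP => //= _.
    rewrite (dS_le (L := D + D)) //; first by rewrite /L2; clear; lia.
    by apply: dS_step da; apply: (td_nr td); rewrite ?ownA // Hs.
  apply: (wm_le nrP (k := size s * (2 * (2 * D) + D))).
    by rewrite leq_mul2r sth orbT.
  apply: (connect_cover nrP (e := mono W H c)) xy => [a b|z xz].
    by case/and4P => /WA aA /WA bA _; apply: td_nr td _ _ aA bA.
  have /andP[_ /sP[w ws zw]] := in_inner z xz.
  by exists w => //; rewrite mul2n -addnn.
(* By [UF] neighbours in [U] are [false], so a [true] component never leaves [own]. *)
have true_own x y : x \in own -> c x -> connect (mono W H c) x y -> nr Fo x y.
  move=> xo cx xy.
  have in_own z : connect (mono W H c) x z -> (z \in own) && c z.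
    move: z; apply: connect_last_ind; first by rewrite xo.
    move=> a b _ /andP[ao ca] /and4P[aW bW /eqP cab Hab].
    rewrite -cab ca andbT; have /orP[//|bU] := ownU b bW.
    by have [cb _] := UF b a bU ao Hab; rewrite cab cb in ca.
  have far_step a b : a \in far -> b \in far -> c a -> mono W H c a b ->
      mono far H' cf a b.
    move=> af bf ca /and4P[aW bW /eqP cab Hab].
    have [/andP[ao da] /andP[bo db]] := (af, bf).
    have nD v : ~~ dS L2 v -> dS D v = false.
      by apply: contraNF; apply: dS_le; rewrite /L2; clear; lia.
    move: cab; rewrite !cown // !nD // (negPf da) (negPf db) => cab.
    have inA1 v : v \in own -> v \in A1.
      by move=> vo; rewrite inE ownA //; case/andP: vo => _ /asboolP[].
    have DR : D <= R by rewrite /R; clear; lia.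
    have Dab := td_nr td (ownA ao) (ownA bo) Hab.
    rewrite /mono /= af bf cab eqxx /= /H' /long_edge /= af bf /=.
    apply/andP; split; apply: connect1; rewrite /induced /= !inA1 // ?Hab ?[H b a]Hs ?Hab /=.
      apply/andP; split; apply/asboolP; first exact: wm_le (wm_refl nrP a).
      exact: wm_le Dab.
    apply/andP; split; apply/asboolP; first exact: wm_le (wm_refl nrP b).
    exact: wm_le (wm_sym nrP Dab).
  have [[m [xm mm]]|nomid] := pselect (exists m,
      connect (mono W H c) x m /\ dS L2 m).
    apply: (wm_le nrP (k := size s * (2 * E2 + D))).
      by apply: leq_trans (leq_addl _ _); rewrite leq_mul2r sth orbT.
    apply: (connect_cover nrP (e := mono W H c)) xy => [a b|z xz].
      by case/and4P => /WA aA /WA bA _; apply: td_nr td _ _ aA bA.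
    have mz : connect (mono W H c) m z.
      by apply: connect_trans xz; rewrite (sym_connect_sym ms).
    (* On a walk from [m] to [z], what follows the last vertex near [p] stays
       in one component of the colouring of [far]. *)
    suff /orP[dz|/existsP[a /andP[fa /existsP[b /andP[dab Dab]]]]] :
        dS L2 z || [exists a, connect (mono far H' cf) a z &&
          [exists b, dS L2 b && `[< nr D a b >]]].
    - have [w ws zw] := sP _ _ dz; exists w => //.
      by apply: wm_le zw => //; rewrite /E2; clear; lia.
    - have [w ws bw] := sP _ _ dab; exists w => //.
      apply: wm_tri bw => //; apply: wm_tri (asboolP _ Dab) => //.
      by apply: wm_sym => //; apply: cfP.
    have [_ cz] := andP (in_own z xz).
    move: z mz {xz cz}; apply: connect_last_ind; first by rewrite mm.
    move=> a b ma IH ab.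
    have xa := connect_trans xm ma; have xb := connect_trans xa (connect1 ab).
    have /andP[ao ca] := in_own a xa; have /andP[bo cb] := in_own b xb.
    have [//|db] := boolP (dS L2 b); rewrite /=.
    have bf : b \in far by rewrite inE bo.
    have [da|da] := boolP (dS L2 a).
      apply/existsP; exists b; rewrite connect0; apply/existsP; exists a.
      rewrite da; apply/asboolP; apply: (wm_sym nrP); case/and4P: ab => aW bW _.
      exact: td_nr td _ _ (WA aW) (WA bW).
    move: IH; rewrite (negPf da) /= => /existsP[a' /andP[a'a h]].
    apply/existsP; exists a'; rewrite h andbT; apply: connect_trans a'a _.
    by apply: connect1; apply: far_step => //; rewrite inE ao.
  apply: (wm_le nrP (k := F')); first by rewrite /Fo; clear; lia.
  apply: cfP; move: (connect_restrict xy); apply: connect_mono => a b.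
  have inf v : connect (mono W H c) x v -> v \in far.
    move=> xv; have /andP[vo _] := in_own v xv; rewrite inE vo.
    by apply/negP => dv; apply: nomid; exists v.
  case/and3P => ab xa xb; apply: far_step; rewrite ?inf //.
  by case/andP: (in_own a xa).
(* Such a component alternates between [false] vertices of [far] and excursions into [U], which [UF]
   bounds by [R0]. After [bypass] it is a walk along [H'], for which [cf] was made. *)
have false_far x y : x \in own -> ~~ dS D x -> c x = false ->
    connect (mono W H c) x y -> nr Fo x y.
  move=> xo dx cx xy.
  pose C := connect (mono W H c) x.
  have in_comp z : C z -> [&& z \in W, le (pi z) p, ~~ c z &
      ~~ ((z \in own) && dS D z)].
    move: z; apply: connect_last_ind.
      by rewrite cx (negPf dx) andbF !andbT; case/andP: xo => -> /asboolP[].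
    move=> a b _ /and4P[aW ap ca da] /and4P[_ bW /eqP cab Hab].
    rewrite bW (below aW bW) // -cab ca /=.
    apply/negP => /andP[bo db].
    have /orP[ao|aU] := ownU a aW.
      move: ca da; rewrite ao cown //=; case: ifP => // _.
      rewrite (dS_le (L := D + D)) //; first by rewrite /L2; clear; lia.
      by apply: dS_step db; apply: (td_nr td); rewrite ?ownA // Hs.
    by have [_] := own_U bo aU (etrans (Hs _ _) Hab); rewrite db.
  pose B := [pred v | (v \in far) && ~~ cf v].
  pose r := [rel a b | [&& mono W H c a b, C a & C b]].
  have compB z : C z -> z \in own -> z \in B.
    move=> /in_comp/and4P[_ _ cz] /[swap] zo; rewrite zo /= => dz.
    move: cz; rewrite cown // (negPf dz); case: ifP => // d2 cz.
    by rewrite inE cz andbT inE zo d2.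
  have Bown z : z \in B -> z \in own by case/andP => /andP[].
  have xB : x \in B by apply: compB => //; apply: connect0.
  have r_sym : symmetric r.
    by move=> a b; rewrite /r /= ms; congr andb; rewrite andbC.
  have rA a b : r a b -> induced A1 H a b.
    case/and3P => /and4P[aW bW _ Hab] /in_comp/and4P[_ ap _ _].
    move=> /in_comp/and4P[_ bp _ _].
    by rewrite /induced /= !inE !WA // ap bp Hab.
  have rD a b : r a b -> nr D a b.
    by case/and3P => /and4P[/WA aA /WA bA _ Hab] _ _; apply: td_nr td _ _ aA bA Hab.
  have short z u y' : z \in B -> r z u -> u \notin B ->
      connect [rel a b | [&& a \notin B, b \notin B & r a b]] u y' ->
      nr R0 u y'.
    move=> zB /and3P[/and4P[_ uW _ Hzu] _ Cu] uB uy.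
    have inU w : C w -> w \notin B -> w \in U.
      move=> Cw; apply: contraR => wU; apply: compB => //.
      have /and4P[wW _ _ _] := in_comp w Cw.
      by move: (ownU w wW); rewrite (negPf wU) orbF.
    have [_ +] := UF u z (inU u Cu uB) (Bown z zB) Hzu; apply.
    apply: connect_mono uy => a b /and3P[aB bB /and3P[/and4P[_ _ cab Hab] Ca Cb]].
    have aU := inU a Ca aB; have bU := inU b Cb bB.
    by rewrite /mono /= aU bU Hab andbT -!cUE.
  have [z [zB xz zy]] := bypass nrP r_sym rA rD short xB (connect_restrict xy).
  apply: (wm_le nrP (k := F' + (D + R0))); first by rewrite /Fo; clear; lia.
  apply: wm_tri zy => //; apply: cfP; apply: connect_mono xz => a b.
  case/and4P => /andP[af ca] /andP[bf cb] ab ba.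
  by rewrite /mono /= af bf (negPf ca) (negPf cb) /= /H' /long_edge /= af bf ab.
have ownF x y : x \in own -> connect (mono W H c) x y -> nr Fo x y.
  move=> xo xy; case: (boolP (c x)) => [cx|/negbTE cx]; first exact: true_own.
  case: (boolP (dS D x)) => dx; last exact: false_far.
  by apply: wm_le (inner x y xo dx xy) => //; rewrite /Fo; clear; lia.
split=> [x y xy|x y z xW zA zW Hxz xy].
  (* Passing through a vertex of [own] costs [Fo] on each side, whence the factor 2 in [good]. *)
  have [[v [xv vo]]|nown] := pselect (exists v,
      connect (mono W H c) x v /\ v \in own).
    have vx : connect (mono W H c) v x by rewrite (sym_connect_sym ms).
    rewrite mul2n -addnn; apply: (wm_tri nrP (y := v)).
      by apply: (wm_sym nrP); apply: ownF.
    by apply: ownF => //; apply: connect_trans vx xy.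
  apply: cU1; move: (connect_restrict xy); apply: connect_mono => a b.
  case/and3P => /and4P[aW bW cab Hab] xa xb.
  have inU w : w \in W -> connect (mono W H c) x w -> w \in U.
    move=> wW xw; have /orP[wo|//] := ownU w wW.
    by case: nown; exists w.
  by rewrite /mono /= !inU // Hab andbT -!cUE ?inU.
have /orP[xo|xU] := ownU x xW.
  have dx := own_out xo zA zW Hxz.
  by rewrite cown // dx; split=> //; apply: inner.
have xp := U_out xU zA zW Hxz.
(* By [below], no edge inside [W] joins the part below [p] to the rest of [W]. *)
have inU w : connect (mono W H c) x w -> (w \in U) && ~~ le (pi w) p.
  move: w; apply: connect_last_ind; first by rewrite xU.
  move=> a b _ /andP[aU ap] /and4P[aW bW _ Hab].
  have bp : ~~ le (pi b) p.
    by apply: contra ap => bp; apply: (below bW aW bp); rewrite Hs.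
  rewrite bp andbT; have /orP[|//] := ownU b bW.
  by case/andP => _ /asboolP[bp']; rewrite bp' in bp.
rewrite cUE //; apply: (cU2 x y z) => //.
  by apply: contra zW => /andP[].
move: (connect_restrict xy); apply: connect_mono => a b.
case/and3P => /and4P[aW bW cab Hab] /inU/andP[aU _] /inU/andP[bU _].
by rewrite /mono /= aU bU Hab andbT -!cUE.
Qed.

End Phase.

Lemma tw_step : exists c : V -> bool, bounded_comps nr (mono A H c) (2 * Fo).
Proof.
suff main W : down_closed W -> exists c, good W c.
  have [|c [cP _]] := main A; first by split.
  by exists c.
have [k] := ubnP #|W|; elim: k W => // k IH W Wk Wdown.
have [[v vW]|W0] := pselect (exists v, v \in W); last first.
  exists (fun=> true); split=> [x y|x y z xW]; last by case: W0; exists x.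
  have nW a : a \in W = false by apply/negP => aW; apply: W0; exists a.
  move: y; apply: connect_last_ind => [|a b _ _].
    exact: wm_le (wm_refl nrP x).
  by rewrite /mono /= nW.
pose N m := #|[pred u | (u \in W) && le (pi u) (pi m)]|.
have [m mW maxm] : exists2 m, m \in W & forall u, u \in W -> N u <= N m.
  by case: (arg_maxnP N vW) => m; exists m.
apply: (phase Wdown mW) => [w wW mw|W' W'down W'W]; last first.
  by apply: IH => //; apply: leq_trans W'W _.
apply/negPn/negP => nwm; have := maxm w wW; rewrite leqNgt => /negP; apply.
apply: proper_card; apply/properP; split.
  by apply/fintype.subsetP => z; rewrite !inE => /andP[-> zm]; apply: (td_trans td zm).
by exists w; rewrite inE wW ?(negPf nwm) //= (td_refl td).
Qed.

End Step.

Theorem coarse_tw_colouring (th D : nat) : exists F : nat,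
  forall (V : finType) (nr : nat -> V -> V -> Prop), walk_metric nr ->
  forall (P : Type) (le : rel P) (A : pred V) (H : rel V) (pi : V -> P)
    (bt : V -> P -> bool),
  tree_dec nr A H le pi bt D -> width nr A bt D th ->
  exists c : V -> bool, bounded_comps nr (mono A H c) F.
Proof.
elim: th D => [|th IH] D.
  (* Without centres all bags are empty, hence so is [A]. *)
  exists 0 => V nr nrP P le A H pi bt td wid; exists (fun=> true) => x.
  apply: connect_last_ind => [|a b _ _]; first exact: wm_refl.
  case/and4P => aA _ _ _; have [s [s0 sP]] := wid (pi a).
  have [w ws _] := sP a aA (td_own td aA).
  by move: s0 ws; rewrite leqn0 => /nilP ->.
have [F' F'P] := IH (D + (2 * D + 2 * (th.+1 * (2 * (2 * D) + D)))).
eexists => V nr nrP P le A H pi bt td wid.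
apply: (tw_step nrP td wid) => B H' pi' bt'; exact: F'P.
Qed.

(** Adding [Y] to a colour class may join many of its components through [Y]. Each passage through
    [Y] has length at most [RY], so colouring the graph of long edges, in which it is a single edge,
    keeps them bounded. *)
Lemma coarse_tw_split (th D RY : nat) : exists F : nat,
  forall (V : finType) (nr : nat -> V -> V -> Prop), walk_metric nr ->
  forall (P : Type) (le : rel P) (A : pred V) (H : rel V) (pi : V -> P)
    (bt : V -> P -> bool),
  tree_dec nr A H le pi bt D -> width nr A bt D th ->
  forall Y : pred V, {subset Y <= A} -> bounded_comps nr (induced Y H) RY ->
  exists C : pred V, [/\ {subset C <= A}, {subset Y <= C},
    bounded_comps nr (induced C H) F &
    bounded_comps nr (induced [pred v | (v \in A) && (v \notin C)] H) F].
Proof.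
pose R := 2 * D + 2 * RY.
have [F0 F0P] := coarse_tw_colouring th (D + R).
exists (2 * (F0 + (D + RY))) => V nr nrP P le A H pi bt td wid Y YA Yb.
have Hs := td_sym td.
have [|//|pi' td'] := td_local nrP R (T := fun=> true) td (fun v => id).
  by [].
have [c cP] := F0P _ _ nrP _ _ _ _ _ _ td'
  (width_local nrP H R (fun=> true) wid (fun v => id)).
pose B := [pred v | (v \in A) && c v].
pose C := [pred v | (v \in B) || (v \in Y)].
have CA : {subset C <= A} by move=> v /orP[/andP[]|/YA].
have DR : D <= R by rewrite /R; clear; lia.
have H_long a b : induced A H a b ->
    long_edge nr A H R A a b.
  case/and3P=> aA bA Hab; have Dab := td_nr td aA bA Hab.
  rewrite /long_edge /= aA bA /=; apply/andP; split; apply: connect1.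
    rewrite /induced /= aA bA Hab /=; apply/andP; split; apply/asboolP.
      exact: wm_le (wm_refl nrP a).
    exact: wm_le Dab.
  rewrite /induced /= aA bA Hs Hab /=; apply/andP; split; apply/asboolP.
    exact: wm_le (wm_refl nrP b).
  exact: wm_le (wm_sym nrP Dab).
exists C; split=> //.
- by move=> v vY; rewrite inE vY orbT.
- pose r := induced C H.
  have r_sym : symmetric r by move=> a b; rewrite /r /induced /= Hs andbCA.
  have rA a b : r a b -> induced A H a b.
    by case/and3P=> /CA aA /CA bA Hab; rewrite /induced /= aA bA.
  have rD a b : r a b -> nr D a b.
    by case/rA/and3P => aA bA Hab; apply: (td_nr td aA bA).
  have short z u y : z \in B -> r z u -> u \notin B ->
      connect [rel a b | [&& a \notin B, b \notin B & r a b]] u y ->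
      nr RY u y.
    move=> zB zu uB uy; apply: Yb; apply: connect_mono uy => a b.
    case/and3P=> aB bB /and3P[aC bC Hab].
    have inY v : v \notin B -> v \in C -> v \in Y.
      by move=> vB; rewrite inE (negPf vB).
    by rewrite /induced /= !inY.
  have fromB x y : x \in B -> connect r x y -> nr (F0 + (D + RY)) x y.
    move=> xB xy; have [z [zB xz zy]] := bypass nrP r_sym rA rD short xB xy.
    apply: (wm_tri nrP _ zy); apply: cP; apply: connect_mono xz => a b.
    case/and4P=> /andP[aA ca] /andP[bA cb] ab ba.
    by rewrite /mono /long_edge /= aA bA ca cb ab.
  move=> x y xy.
  have [[b [bB xb]]|nB] := pselect (exists b, b \in B /\ connect r x b).
    have bx : connect r b x by rewrite (sym_connect_sym r_sym).
    rewrite mul2n -addnn; apply: (wm_tri nrP (y := b)).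
      by apply: (wm_sym nrP); apply: fromB.
    by apply: fromB => //; apply: connect_trans bx xy.
  apply: (wm_le nrP (k := RY)); first by clear; lia.
  apply: Yb; move: (connect_restrict xy); apply: connect_mono => a b.
  case/and3P=> /and3P[aC bC Hab] xa xb.
  have inY v : v \in C -> connect r x v -> v \in Y.
    by move=> /orP[vB|//] xv; case: nB; exists v.
  by rewrite /induced /= !inY.
- move=> x y xy; apply: (wm_le nrP (k := F0)); first by clear; lia.
  apply: cP; apply: connect_mono xy => a b.
  case/and3P=> /andP[aA aC] /andP[bA bC] Hab.
  have cF v : v \in A -> v \notin C -> c v = false.
    by move=> vA; rewrite !inE vA; case: (c v).
  rewrite /mono /= aA bA !cF //=; apply: H_long.
  by rewrite /induced /= aA bA.
Qed.

(** * Merging the classes *)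

Definition near_rel (V : finType) (nr : nat -> V -> V -> Prop) (k : nat) :
    rel V := [rel x y | `[< nr k x y >]].

Definition thin_tree (V : finType) (nr : nat -> V -> V -> Prop) (A : pred V)
    (k D th : nat) : Prop :=
  exists (P : Type) (le : rel P) (pi : V -> P) (bt : V -> P -> bool),
    tree_dec nr A (near_rel nr k) le pi bt D /\ width nr A bt D th.

(* Colour [0] is given to the part [C] of the first class produced by
   [coarse_tw_split]; the rest [Z] of the class can then share colour [1] with
   the remaining classes, because [C] absorbs whatever is near that colour. *)
Lemma thin_tree_colouring (th D m k : nat) : exists F : nat,
  forall (V : finType) (nr : nat -> V -> V -> Prop), walk_metric nr ->
  forall (X : pred V) (A : nat -> pred V),
  (forall v, v \in X -> exists2 a, a < m & v \in A a) ->
  (forall a, a < m -> thin_tree nr (A a) (3 ^ a * k) D th) ->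
  exists col : V -> nat, (forall v, col v <= m) /\
    bounded_comps nr (mono X (near_rel nr k) col) F.
Proof.
elim: m k => [|m IH] k.
  exists 0 => V nr nrP X A cov _; exists (fun=> 0); split=> // x.
  apply: connect_last_ind => [|a b _ _]; first exact: wm_refl.
  by case/and4P => aX; have [] := cov a aX.
(* Vertices of [Y] within [k] of each other have witnesses of colour 0 within [k + k + k]. At scale
   [3 * k] these witnesses lie in one component, so the components of [Y] are bounded by
   [F + 2 * k]. *)
have [F F1] := IH (3 * k).
have [F' F2] := coarse_tw_split th D (F + 2 * k).
exists (F + F') => V nr nrP X A cov thin.
pose X' := [pred v | (v \in X) && (v \notin A 0)].
have [||col' [col'm col'P]] := F1 V nr nrP X' (fun a => A a.+1).
- move=> v /andP[vX vA]; have [[|a] am va] := cov v vX; last by exists a.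
  by rewrite va in vA.
- by move=> a am; rewrite mulnA -expnSr; apply: thin.
have [P [le [pi [bt [td wid]]]]] := thin 0 isT.
rewrite expn0 mul1n in td wid.
pose X0 := [pred v | (v \in X) && (v \in A 0)].
have X0A : {subset X0 <= A 0} by move=> v /andP[].
pose Y := [pred v | (v \in X0) &&
  [exists w, [&& w \in X', col' w == 0 & `[< nr k v w >]]]].
have YX0 : {subset Y <= X0} by move=> v /andP[].
have wid0 : width nr X0 bt D th.
  move=> p; have [s [sth sP]] := wid p.
  by exists s; split=> // v /X0A; apply: sP.
have [|C [CX0 YC Cb Zb]] :=
    F2 V nr nrP _ _ _ _ _ _ (tree_dec_sub X0A td) wid0 Y YX0.
  pose wit v w := [&& w \in X', col' w == 0 & `[< nr k v w >]].
  move=> x y xy; have [xY|xY] := boolP (x \in Y); last first.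
    suff -> : y = x by apply: wm_le (wm_refl nrP x).
    case/connectP: xy => [[|z p] //= /andP[]].
    by rewrite /induced /= (negPf xY).
  case/andP: (xY) => _ /existsP[w xw]; pose Q y := exists2 w', wit y w' &
    connect (mono X' (near_rel nr (3 * k)) col') w w'.
  have [w' /and3P[_ _ /asboolP yw'] ww'] : Q y.
    move: y xy; apply: connect_last_ind; first by exists w.
    move=> a b _ [w' aw' ww'] /and3P[aY /andP[_ /existsP[w2 bw2]] /asboolP ab].
    exists w2 => //; apply: connect_trans ww' _; apply: connect1.
    move: aw' bw2 => /and3P[wX wc /asboolP vw] /and3P[wX' wc' /asboolP vw'].
    rewrite /mono /near_rel /= wX wX' (eqP wc) (eqP wc') eqxx /=.
    apply/asboolP.
    apply: wm_le (wm_tri nrP (wm_sym nrP vw) (wm_tri nrP ab vw')) => //.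
    by clear; lia.
  case/and3P: xw => _ _ /asboolP xw.
  apply: wm_le (wm_tri nrP xw (wm_tri nrP (col'P _ _ ww') (wm_sym nrP yw'))) => //.
  by clear; lia.
pose col v := if v \in A 0 then (v \notin C : nat) else (col' v).+1.
exists col; split=> [v|x y].
  by rewrite /col; case: ifP => _; [case: (v \notin C) | apply: col'm].
have [xX|xX] := boolP (x \in X); last first.
  move=> xy; suff -> : y = x by apply: wm_le (wm_refl nrP x).
  case/connectP: xy => [[|z p] //= /andP[]].
  by rewrite /mono /= (negPf xX).
have [xA|xA] := boolP (x \in A 0).
  have x0 : x \in X0 by rewrite inE xX.
  have [xC|xC] := boolP (x \in C).
    move=> xy; apply: (wm_le nrP (k := F')); first by clear; lia.
    apply: Cb.
    have inC b : connect (mono X (near_rel nr k) col) x b -> b \in C.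
      move: b; apply: connect_last_ind => // a b _ aC /and4P[_ bX /eqP + _].
      rewrite /col (X0A _ (CX0 _ aC)) aC /=; case: ifP => // _.
      by case: (b \in C).
    move: (connect_restrict xy); apply: connect_mono => a b.
    case/and3P => /and4P[_ _ _ ab] /inC aC /inC bC.
    by rewrite /induced /= aC bC.
  move=> xy; apply: (wm_le nrP (k := F')); first by clear; lia.
  apply: Zb.
  have inZ b : connect (mono X (near_rel nr k) col) x b ->
      (b \in X0) && (b \notin C).
    move: b; apply: connect_last_ind => [|a b _ /andP[aX0 aC]].
      by rewrite x0.
    case/and4P=> aX bX /eqP + ab; rewrite /col (X0A _ aX0) aC.
    case: ifPn => [bA|bA [b0]]; first by rewrite inE bX bA; case: (b \in C).
    case/negP: aC; apply: YC; rewrite inE aX0; apply/existsP; exists b.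
    by rewrite inE bX bA -b0 eqxx.
  move: (connect_restrict xy); apply: connect_mono => a b.
  case/and3P => /and4P[_ _ _ ab] /inZ aZ /inZ bZ.
  by rewrite /induced /= !inE aZ bZ.
move=> xy; apply: (wm_le nrP (k := F)); first by clear; lia.
apply: col'P.
have inX' b : connect (mono X (near_rel nr k) col) x b -> b \in X'.
  move: b; apply: connect_last_ind => [|a b _ /andP[aX aA]].
    by rewrite inE xX.
  case/and4P=> _ bX /eqP + ab; rewrite /col (negPf aA) inE bX.
  case: ifPn => // bA; have [//|bC [a0]] := boolP (b \in C).
  case/negP: bC; apply: YC; rewrite inE inE bX bA; apply/existsP; exists a.
  rewrite inE aX aA -a0 eqxx /=; apply/asboolP; apply: (wm_sym nrP).
  exact/asboolP.
move: (connect_restrict xy); apply: connect_mono => a b.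
case/and3P => /and4P[_ _ cab /asboolP ab] /inX' aX' /inX' bX'.
rewrite /mono /= aX' bX' /=; move: cab; case/andP: aX' => _ /negPf aA.
case/andP: bX' => _ /negPf bA; rewrite /col aA bA eqSS => -> /=.
by apply/asboolP; apply: wm_le ab => //; clear; lia.
Qed.

(** * The forest of components of sublevel sets of a key *)

Section KeyTree.
Variables (V : finType) (nr : nat -> V -> V -> Prop).
Variables (A : pred V) (H : rel V) (key : V -> nat) (D : nat).
Hypotheses (H_sym : symmetric H).
Hypothesis H_nr : forall v w, v \in A -> w \in A -> H v w -> nr D v w.

Definition key_step (k : nat) : rel V :=
  [rel a b | [&& induced A H a b, key a <= k & key b <= k]].

(* [key_le v w]: [v] lies in the component of [w] among the vertices of key at
   most [key w]. *)
Definition key_le (v w : V) : bool := connect (key_step (key w)) w v.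

(** As in an elimination forest, a component of small key has in its bag the vertices of larger key
    adjacent to it. Keys may coincide, so a node is a class of mutually comparable vertices. *)
Definition key_bag (w v : V) : bool :=
  key_le v w && key_le w v ||
  (key v < key w) && [exists u, [&& u \in A, key_le u v & H u w]].

Let step_sym k : connect_sym (key_step k).
Proof.
apply: sym_connect_sym => a b; rewrite /key_step /induced /= H_sym.
by rewrite (andbCA (a \in A)); congr andb; rewrite andbC.
Qed.

Let step_le k k' v w : k <= k' ->
  connect (key_step k) v w -> connect (key_step k') v w.
Proof.
move=> kk; apply: connect_mono => a b /and3P[ab ak bk].
by rewrite /key_step /= ab (leq_trans ak kk) (leq_trans bk kk).
Qed.

Lemma key_le_key v w : key_le v w -> key v <= key w.
Proof.
by rewrite /key_le; move: v; apply: connect_last_ind => // a b _ _ /and3P[].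
Qed.

Let key_le_trans : forall u v w, key_le u v -> key_le v w -> key_le u w.
Proof.
move=> u v w uv vw; apply: (connect_trans vw).
exact: step_le (key_le_key vw) uv.
Qed.

Lemma key_tree_dec : tree_dec nr A H key_le id key_bag D.
Proof.
split=> //.
- by move=> p; apply: connect0.
- move=> p q r pq pr.
  have lin a b : key a <= key b -> key_le p a -> key_le p b -> key_le a b.
    move=> ab pa pb; apply: (connect_trans pb).
    by rewrite step_sym; apply: step_le ab pa.
  by have [qr|/ltnW rq] := leqP (key q) (key r); [left|right]; apply: lin.
- by move=> v _; rewrite /key_bag /key_le connect0.
- move=> v p vA /orP[/andP[]//|/andP[kpv /existsP[u /and3P[uA up Huv]]]].
  have ku := leq_trans (key_le_key up) (ltnW kpv).
  apply: (connect_trans (y := u)).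
    by apply: connect1; rewrite /key_step /induced /= vA uA H_sym Huv leqnn ku.
  by rewrite step_sym; apply: step_le (ltnW kpv) up.
- move=> v p q vA /orP[/andP[_ vp]|].
    by move=> pq qv; rewrite /key_bag qv (key_le_trans vp pq).
  case/andP=> kpv /existsP[u /and3P[uA up Huv]] pq qv.
  have [kqv|kqv] := ltnP (key q) (key v).
    apply/orP; right; rewrite kqv; apply/existsP; exists u.
    by rewrite uA Huv (key_le_trans up pq).
  apply/orP; left; rewrite qv /key_le step_sym.
  by apply: step_le qv.
- have edge v w : v \in A -> w \in A -> H v w -> key v <= key w ->
      key_le v w /\ key_bag w v.
    move=> vA wA Hvw kvw.
    have vw : key_le v w.
      by apply: connect1; rewrite /key_step /induced /= wA vA H_sym Hvw kvw leqnn.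
    split=> //; move: kvw; rewrite leq_eqVlt => /orP[/eqP kvw|kvw]; apply/orP.
      left; rewrite vw /= /key_le kvw step_sym; exact: vw.
    right; rewrite kvw; apply/existsP; exists v; rewrite vA Hvw.
    by rewrite /key_le connect0.
  move=> v w vA wA Hvw; have [vw|/ltnW wv] := leqP (key v) (key w).
    by left; apply: edge.
  by right; apply: edge => //; rewrite H_sym.
Qed.

End KeyTree.

Section Near.
Variables (T : Type) (t : T -> T -> Prop).

(** Walks of exactly [k] steps; for reflexive [t] this is distance at most [k]. *)
Fixpoint near (k : nat) (x y : T) : Prop :=
  if k is k'.+1 then exists z, near k' x z /\ t z y else x = y.

Lemma near_ind (P : nat -> T -> Prop) k x y : P 0 x ->
  (forall j a b, j < k -> near j x a -> P j a -> t a b -> P j.+1 b) ->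
  near k x y -> P k y.
Proof.
move=> P0 PS; elim: k y PS => [|k IH] y PS; first by move=> /= <-.
move=> [z [xz zy]]; apply: (PS k z) => //; apply: IH => // j a b jk.
by apply: PS; apply: ltnW.
Qed.

Hypothesis t_refl : forall x, t x x.
Hypothesis t_sym : forall x y, t x y -> t y x.

Lemma near_walk_metric : walk_metric near.
Proof.
have tri k l x y z : near k x y -> near l y z -> near (k + l) x z.
  move=> xy; apply: (near_ind (P := fun l z => near (k + l) x z)).
    by rewrite addn0.
  by move=> j a b _ _ xa ab; rewrite addnS; exists a.
have sym k x y : near k x y -> near k y x.
  apply: (near_ind (P := fun k y => near k y x)) => // j a b _ _ ax ab.
  by rewrite -add1n; apply: tri ax; exists b; split=> //; apply: t_sym.
split=> // k l x y; elim: l => [|l IH]; first by rewrite leqn0 => /eqP ->.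
rewrite leq_eqVlt => /orP[/eqP -> //|kl xy]; exists y; split=> //.
exact: IH.
Qed.

End Near.

Lemma near_map (T T' : Type) (t : T -> T -> Prop) (t' : T' -> T' -> Prop)
    (f : T -> T') k x y :
  (forall a b, t a b -> t' (f a) (f b)) -> near t k x y -> near t' k (f x) (f y).
Proof.
move=> tt; elim: k y => [|k IH] y /=; first by move=> ->.
by move=> [z [xz zy]]; exists (f z); split; [apply: IH | apply: tt].
Qed.

Lemma separated_net (V : finType) (S : pred V) (e : rel V) :
  reflexive e -> symmetric e -> exists s : seq V,
  [/\ uniq s, {subset s <= S},
      forall x y, x \in s -> y \in s -> x != y -> ~~ e x y &
      forall w, w \in S -> exists2 x, x \in s & e w x].
Proof.
move=> e_refl e_sym.
suff [s [h1 h2 h3 h4]] : exists s : seq V,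
  [/\ uniq s, {subset s <= S},
      forall x y, x \in s -> y \in s -> x != y -> ~~ e x y &
      forall w, w \in S -> w \in enum V -> exists2 x, x \in s & e w x].
  by exists s; split=> // w wS; apply: h4; rewrite ?mem_enum.
elim: (enum V) => [|v l [s [h1 h2 h3 h4]]]; first by exists [::].
have [/andP[vS vs]|vs] := boolP ((v \in S) && ~~ has (e v) s); last first.
  exists s; split=> // w wS; rewrite inE => /orP[/eqP wv|]; last exact: h4.
  move: vs; rewrite -wv wS /= negbK => /hasP[x xs ex].
  by exists x.
have {}vs x : x \in s -> ~~ e v x by apply/hasPn.
exists (v :: s); split=> /=.
- rewrite h1 andbT; apply/negP => /vs; by rewrite e_refl.
- by move=> x; rewrite inE => /orP[/eqP ->|/h2].
- move=> x y; rewrite !inE => /orP[/eqP ->|xs] /orP[/eqP ->|ys].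
  + by rewrite eqxx.
  + by move=> _; apply: vs.
  + by move=> _; rewrite e_sym; apply: vs.
  + exact: h3.
- move=> w wS; rewrite inE => /orP[/eqP ->|wl].
    by exists v; rewrite ?mem_head.
  by have [x xs wx] := h4 w wS wl; exists x; rewrite // inE xs orbT.
Qed.

Import Order.TTheory GRing.Theory Num.Theory.
Import numFieldNormedType.Exports.
Local Open Scope classical_set_scope.
Local Open Scope ring_scope.

(** * Spheres and grids in Euclidean space *)

Section Euclid.
Variables (R : realType) (n : nat).
Implicit Types (x y z v : 'rV[R]_n).

Definition edot x y : R := \sum_(i < n) x ord0 i * y ord0 i.

Lemma edotC x y : edot x y = edot y x.
Proof. by apply: eq_bigr => i _; rewrite mulrC. Qed.

Lemma edotDl x y z : edot (x + y) z = edot x z + edot y z.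
Proof. by rewrite -big_split; apply: eq_bigr => i _; rewrite mxE mulrDl. Qed.

Lemma edotZl a x y : edot (a *: x) y = a * edot x y.
Proof. by rewrite big_distrr; apply: eq_bigr => i _; rewrite mxE /= mulrA. Qed.

Lemma edotDr x y z : edot x (y + z) = edot x y + edot x z.
Proof. by rewrite ![edot x _]edotC edotDl. Qed.

Lemma edotZr a x y : edot x (a *: y) = a * edot x y.
Proof. by rewrite ![edot x _]edotC edotZl. Qed.

Lemma edot_ge0 x : 0 <= edot x x.
Proof. by apply: sumr_ge0 => i _; rewrite -expr2 sqr_ge0. Qed.

Lemma edot_eq0 x : edot x x = 0 -> x = 0.
Proof.
move=> /psumr_eq0P x0; apply/rowP => i; rewrite mxE; apply/eqP.
rewrite -sqrf_eq0 expr2; apply/eqP; apply: x0 => // j _.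
by rewrite -expr2 sqr_ge0.
Qed.

Lemma enormE x : enorm x = Num.sqrt (edot x x).
Proof. by congr Num.sqrt; apply: eq_bigr => i _; rewrite expr2. Qed.

Lemma enorm_ge0 x : 0 <= enorm x.
Proof. exact: sqrtr_ge0. Qed.

Lemma enorm_sqr x : enorm x ^+ 2 = edot x x.
Proof. by rewrite enormE sqr_sqrtr // edot_ge0. Qed.

Lemma enormZ a x : enorm (a *: x) = `|a| * enorm x.
Proof.
by rewrite !enormE edotZl edotZr mulrA -expr2 sqrtrM ?sqr_ge0 // sqrtr_sqr.
Qed.

Lemma enormN x : enorm (- x) = enorm x.
Proof. by rewrite -scaleN1r enormZ normrN1 mul1r. Qed.

Lemma enorm_sub x y : enorm (x - y) = enorm (y - x).
Proof. by rewrite -opprB enormN. Qed.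

Lemma enorm0 : enorm (0 : 'rV[R]_n) = 0.
Proof. by rewrite -[X in enorm X](scale0r 0) enormZ normr0 mul0r. Qed.

Lemma edot_le x y : edot x y <= enorm x * enorm y.
Proof.
have [y0|yn0] := eqVneq (edot y y) 0.
  rewrite (edot_eq0 y0) enorm0 mulr0 /edot big1 // => i _.
  by rewrite mxE mulr0.
have yp : 0 < edot y y by rewrite lt_neqAle eq_sym yn0 edot_ge0.
have := edot_ge0 (edot y y *: x - edot x y *: y).
rewrite !(edotDl, edotDr, edotZl, edotZr, =^~ scaleNr).
rewrite (edotC y x) => h.
have {h} : edot x y ^+ 2 <= (enorm x * enorm y) ^+ 2.
  rewrite exprMn !enorm_sqr -(ler_pM2l yp) -subr_ge0.
  by apply: le_trans h _; rewrite le_eqVlt; apply/orP; left; apply/eqP; ring.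
have : 0 <= enorm x * enorm y by rewrite mulr_ge0 ?enorm_ge0.
move: (edot x y) (enorm x * enorm y) => a b b0 ab.
by rewrite leNgt; apply/negP => ?; nra.
Qed.

Lemma enorm_triangle x y : enorm (x + y) <= enorm x + enorm y.
Proof.
have := enorm_ge0 x; have := enorm_ge0 y; have := enorm_ge0 (x + y).
have := edot_le x y; have := enorm_sqr (x + y).
rewrite !(edotDl, edotDr) -!enorm_sqr (edotC y x).
move: (enorm _) (enorm x) (enorm y) (edot x y) => a b c d *.
by rewrite leNgt; apply/negP => ?; nra.
Qed.

Lemma enorm_triangle3 x y z : enorm (x - z) <= enorm (x - y) + enorm (y - z).
Proof. by have := enorm_triangle (x - y) (y - z); rewrite addrA subrK. Qed.

Lemma coord_le_enorm x i : `|x ord0 i| <= enorm x.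
Proof.
have := enorm_sqr x; have := enorm_ge0 x; have := sqr_ge0 (x ord0 i).
have : x ord0 i ^+ 2 <= edot x x.
  rewrite /edot (bigD1 i) //= expr2 lerDl sumr_ge0 // => j _.
  by rewrite -expr2 sqr_ge0.
rewrite -(real_normK (num_real (x ord0 i))); have := normr_ge0 (x ord0 i).
move: (enorm x) (edot x x) `|x ord0 i| => a b c *.
by rewrite leNgt; apply/negP => ?; nra.
Qed.

Lemma edot_delta x i : edot x (delta_mx ord0 i) = x ord0 i.
Proof.
rewrite /edot (bigD1 i) //= mxE !eqxx mulr1 big1 ?addr0 // => j ji.
by rewrite mxE (negPf ji) mulr0.
Qed.

Lemma enorm_delta i : enorm (delta_mx ord0 i : 'rV[R]_n) = 1.
Proof. by rewrite enormE edot_delta mxE !eqxx sqrtr1. Qed.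

Lemma enorm_le_sum x : enorm x <= \sum_(i < n) `|x ord0 i|.
Proof.
rewrite [X in enorm X]row_sum_delta.
elim/big_ind2: _ => [|a a' b b' aa bb|i _]; first by rewrite enorm0.
  exact: le_trans (enorm_triangle _ _) (lerD aa bb).
by rewrite enormZ enorm_delta mulr1.
Qed.

Lemma enorm_eq0 x : enorm x = 0 -> x = 0.
Proof. by move=> x0; apply: edot_eq0; rewrite -enorm_sqr x0 expr0n. Qed.

End Euclid.

Section Spheres.
Variables (R : realType) (n : nat).
Hypothesis n2 : (2 <= n)%N.
Implicit Types (x y z v c : 'rV[R]_n).

Lemma exists_orthogonal_unit v : exists f : 'rV[R]_n, edot v f = 0 /\ enorm f = 1.
Proof.
have n0 : (0 < n)%N by apply: leq_trans n2.
pose i0 : 'I_n := Ordinal n0; pose i1 : 'I_n := Ordinal n2.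
have i01 : i1 != i0 by [].
have [v0|v0] := eqVneq (v ord0 i0) 0.
  by exists (delta_mx ord0 i0); rewrite edot_delta enorm_delta.
pose g : 'rV[R]_n := v ord0 i1 *: delta_mx ord0 i0 - v ord0 i0 *: delta_mx ord0 i1.
have vg : edot v g = 0.
  rewrite /g edotDr -scaleNr !edotZr !edot_delta; ring.
have g0 : enorm g != 0.
  apply/eqP => /enorm_eq0/rowP/(_ i1); rewrite !mxE !eqxx (negPf i01) /=.
  by rewrite mulr0 mulr1 sub0r => /eqP; rewrite oppr_eq0 (negPf v0).
exists ((enorm g)^-1 *: g); rewrite edotZr vg mulr0 enormZ; split=> //.
by rewrite ger0_norm ?invr_ge0 ?enorm_ge0 // mulVf.
Qed.

(* The intersection point is found in the plane of the line of centres and a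
   direction orthogonal to it. *)
Lemma spheres_meet (c1 c2 : 'rV[R]_n) (r1 r2 : R) : 0 < r1 -> 0 < r2 ->
  enorm (c1 - c2) <= r1 + r2 -> r1 - r2 <= enorm (c1 - c2) ->
  r2 - r1 <= enorm (c1 - c2) ->
  exists x, enorm (x - c1) = r1 /\ enorm (x - c2) = r2.
Proof.
rewrite (enorm_sub c1) => r1p r2p.
set v := c2 - c1; have : c2 = c1 + v by rewrite addrC subrK.
move: v => v ->; set d := enorm v => h1 h2 h3.
have [f [vf f1]] := exists_orthogonal_unit v.
have normP u r : 0 <= r -> edot u u = r ^+ 2 -> enorm u = r.
  by move=> r0 E; rewrite enormE E sqrtr_sqr ger0_norm.
have ff : edot f f = 1 by rewrite -enorm_sqr f1 expr1n.
have [d0|dn0] := eqVneq d 0.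
  have v0 := enorm_eq0 d0.
  have r12 : r2 = r1 by move: h2 h3; rewrite d0; lra.
  exists (c1 + r1 *: f); rewrite v0 r12 addr0 (addrC c1) addrK enormZ f1 mulr1.
  by rewrite ger0_norm // ltW.
have dp : 0 < d by rewrite lt_neqAle eq_sym dn0 enorm_ge0.
(* The coordinate along the line of centres, found by subtracting the two sphere equations; [be] is
   the height above that line. *)
pose al := (d ^+ 2 + r1 ^+ 2 - r2 ^+ 2) / (2 * d).
have alE : al * (2 * d) = d ^+ 2 + r1 ^+ 2 - r2 ^+ 2.
  by rewrite /al divfK // mulf_neq0 // pnatr_eq0.
have al1 : al ^+ 2 <= r1 ^+ 2.
  have : - r1 <= al /\ al <= r1.
    by split; rewrite -(ler_pM2r (mulr_gt0 (ltr0Sn R 1) dp)) alE; nra.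
  by move=> []; nra.
pose be := Num.sqrt (r1 ^+ 2 - al ^+ 2).
have beE : be ^+ 2 = r1 ^+ 2 - al ^+ 2 by rewrite sqr_sqrtr // subr_ge0.
have vv : edot v v = d ^+ 2 by rewrite -enorm_sqr.
exists (c1 + ((al / d) *: v + be *: f)); split; apply: normP; rewrite ?ltW //.
  rewrite (addrC c1) addrK !(edotDl, edotDr, edotZl, edotZr) (edotC f v) vf vv ff.
  rewrite -[r1 ^+ 2](subrK (al ^+ 2)) -beE; by field.
have -> : c1 + ((al / d) *: v + be *: f) - (c1 + v) = (al / d - 1) *: v + be *: f.
  by rewrite scalerBl scale1r opprD addrACA subrr add0r addrAC.
rewrite !(edotDl, edotDr, edotZl, edotZr) (edotC f v) vf vv ff.
have -> : r2 ^+ 2 = be ^+ 2 + al ^+ 2 - al * (2 * d) + d ^+ 2.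
  by rewrite alE beE; ring.
by field.
Qed.

End Spheres.

Section Cells.
Variables (R : realType) (n : nat) (s0 : R).
Hypothesis s0_gt0 : 0 < s0.

Definition cell_size (k : nat) : R := s0 * n.+2%:R ^+ k.

Definition cell (a k : nat) (x : R) : int :=
  Num.floor (x / cell_size k - a%:R / n.+1%:R).

Lemma cell_size_gt0 k : 0 < cell_size k.
Proof. by rewrite mulr_gt0 ?exprn_gt0 ?ltr0Sn. Qed.

Lemma cell_le a k x y : x <= y -> cell a k x <= cell a k y.
Proof.
move=> xy; apply: Num.Theory.le_floor; rewrite lerD2r ler_pM2r //.
by rewrite invr_gt0 cell_size_gt0.
Qed.

Lemma cell_between a k x y z : x <= y -> y <= z ->
  cell a k x = cell a k z -> cell a k y = cell a k x.
Proof.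
move=> /(cell_le a k) xy /(cell_le a k) yz xz; apply/eqP.
by rewrite eq_le xy {1}xz yz.
Qed.

Lemma cell_dist a k x y : cell a k x = cell a k y -> x - y <= cell_size k.
Proof.
move=> xy; have := Num.Theory.floor_itv (x / cell_size k - a%:R / n.+1%:R).
have := Num.Theory.floor_itv (y / cell_size k - a%:R / n.+1%:R).
rewrite -/(cell a k x) -/(cell a k y) xy !intrD -![1%:~R]/(1 : R) => /andP[y1 _] /andP[_ x2].
have : (x - y) / cell_size k <= 1.
  rewrite mulrBl; move: y1 x2; move: (x / _) (y / _) (_ / n.+1%:R) => u v w.
  by move: (_%:~R) => *; lra.
by rewrite ler_pdivrMr ?cell_size_gt0 // mul1r.
Qed.

Lemma floor_div (b : nat) (x y : R) : (0 < b)%N ->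
  Num.floor x = Num.floor y -> Num.floor (x / b%:R) = Num.floor (y / b%:R).
Proof.
move=> b0 xy; have bp : 0 < b%:R :> R by rewrite ltr0n.
have le (u v : R) : Num.floor u = Num.floor v ->
    Num.floor (u / b%:R) <= Num.floor (v / b%:R).
  move=> uv; rewrite Num.Theory.floor_ge_int ler_pdivlMr //.
  have -> : (Num.floor (u / b%:R))%:~R * b%:R =
      (Num.floor (u / b%:R) * b%:Z)%:~R :> R by rewrite intrM.
  rewrite -Num.Theory.floor_ge_int -uv Num.Theory.floor_ge_int intrM.
  by rewrite -ler_pdivlMr // Num.Theory.floor_le.
by apply/eqP; rewrite eq_le !le.
Qed.

(* The shifts a/(n+1) are compatible with the factor n+2 between consecutive
   sizes because (n+2) a/(n+1) and a/(n+1) differ by the integer a. *)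
Lemma cell_nest a k l x y : (k <= l)%N ->
  cell a k x = cell a k y -> cell a l x = cell a l y.
Proof.
elim: l => [|l IH]; first by rewrite leqn0 => /eqP ->.
rewrite leq_eqVlt => /orP[/eqP -> //|kl xy]; move: {IH kl xy}(IH kl xy) => xy.
have E z : z / cell_size l.+1 - a%:R / n.+1%:R =
    (z / cell_size l - a%:R / n.+1%:R - a%:R) / n.+2%:R.
  have s1 : s0 != 0 by rewrite gt_eqF.
  have b1 : n.+2%:R ^+ l != 0 :> R by rewrite expf_neq0 // pnatr_eq0.
  rewrite /cell_size exprSr; move: b1; move: (n.+2%:R ^+ l) => B b1.
  by field; rewrite s1 b1 -natrD nat1r !pnatr_eq0.
rewrite /cell !E; apply: floor_div => //.
have F z : Num.floor (z / cell_size l - a%:R / n.+1%:R - a%:R) =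
    cell a l z + Num.floor (- a%:R : R).
  by rewrite Num.Theory.floorDrz // rpredN natr_int.
by rewrite !F xy.
Qed.

(** The walls of all shifts at level [k] are the multiples of [cell_size k / n.+1], the shift being
    the residue mod [n.+1]. An interval shorter than this spacing contains at most one of them. *)
Lemma cell_shift_inj a a' k x y : (a <= n)%N -> (a' <= n)%N ->
  (y - x) * n.+1%:R < cell_size k -> x <= y ->
  cell a k x <> cell a k y -> cell a' k x <> cell a' k y -> a = a'.
Proof.
move=> an an' small xy bad bad'.
have sp := cell_size_gt0 k.
have hit b : (b <= n)%N -> cell b k x <> cell b k y -> exists N : int,
    x / cell_size k * n.+1%:R < (N * n.+1 + b)%:~R
      <= y / cell_size k * n.+1%:R.
  move=> _ /eqP ne; exists (cell b k y).
  have lt : cell b k x < cell b k y by rewrite lt_neqAle ne cell_le.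
  have np : 0 < n.+1%:R :> R by rewrite ltr0n.
  have E z : z / cell_size k * n.+1%:R =
      (z / cell_size k - b%:R / n.+1%:R) * n.+1%:R + b%:R.
    by rewrite mulrBl divfK ?subrK // gt_eqF.
  rewrite intrD intrM -!pmulrn !E lerD2r ltrD2r ler_pM2r // ltr_pM2r //.
  by rewrite -Num.Theory.floor_lt_int lt Num.Theory.floor_le.
have [N /andP[N1 N2]] := hit a an bad.
have [N' /andP[N1' N2']] := hit a' an' bad'.
have w1 : (y / cell_size k * n.+1%:R) - (x / cell_size k * n.+1%:R) < 1.
  by rewrite -mulrBl -mulrBl mulrAC ltr_pdivrMr // mul1r.
have E : N * n.+1 + a = N' * n.+1 + a' :> int.
  apply/eqP; rewrite eq_le; apply/andP; split; rewrite -ltzD1 -(ltr_int R) intrD; lra.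
have := congr1 (fun z : int => (z %% n.+1)%Z) E.
rewrite !modzMDl !modz_small ?ltz_nat ?ltnS //.
by case.
Qed.

(** Each bad shift is charged to a coordinate whose interval it cuts, injectively by
    [cell_shift_inj]; there are [n.+1] shifts and [n] coordinates. *)
Lemma exists_good_shift k (x : 'I_n -> R) (w : R) : 0 <= w ->
  2 * w * n.+1%:R < cell_size k ->
  exists a : 'I_n.+1, forall m, cell a k (x m - w) = cell a k (x m + w).
Proof.
move=> w0 small; apply: contrapT => none.
have /choice[f fP] (a : 'I_n.+1) : exists m, cell a k (x m - w) <> cell a k (x m + w).
  by apply: contrapT => h; apply: none; exists a => m; apply: contrapT => ?; apply: h; exists m.
have finj : injective f.
  move=> a a' E; apply: val_inj.
  apply: (@cell_shift_inj _ _ k (x (f a) - w) (x (f a) + w)) (fP a) _.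
  - by rewrite -ltnS ltn_ord.
  - by rewrite -ltnS ltn_ord.
  - by apply: le_lt_trans small; rewrite le_eqVlt; apply/orP; left; apply/eqP; ring.
  - by lra.
  - by rewrite E; apply: fP.
by have := leq_card f finj; rewrite !card_ord ltnn.
Qed.

End Cells.

Section Packing.
Variables (R : realType) (n : nat).
Hypothesis n_gt0 : (0 < n)%N.

(** In cubes of side [2 * lam / n] two points differ by less than [2 * lam] even in the sum norm, so
    each cube holds at most one point. *)
Lemma packing (T : eqType) (s : seq T) (z : T -> 'rV[R]_n) (x0 : 'rV[R]_n)
    (lam : R) (C : nat) : 0 < lam -> uniq s ->
  (forall i, i \in s -> forall m, `|z i ord0 m - x0 ord0 m| <= C%:R * lam) ->
  (forall i j, i \in s -> j \in s -> i != j -> 2 * lam <= enorm (z i - z j)) ->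
  (size s <= (C * n).+1 ^ n)%N.
Proof.
move=> lam0 us box sep.
have np : 0 < n%:R :> R by rewrite ltr0n.
pose y i m := (z i ord0 m - x0 ord0 m + C%:R * lam) / (2 * lam / n%:R).
have gp : 0 < 2 * lam / n%:R by rewrite divr_gt0 // mulr_gt0.
have y_ge0 i m : i \in s -> 0 <= y i m.
  move=> /box/(_ m); rewrite ler_norml => /andP[h _].
  by rewrite divr_ge0 ?(ltW gp) // -(subrr (C%:R * lam)) addrC lerD2r; lra.
have y_le i m : i \in s -> y i m <= (C * n)%:R.
  move=> /box/(_ m); rewrite ler_norml => /andP[_ h].
  rewrite ler_pdivrMr // natrM.
  have -> : C%:R * n%:R * (2 * lam / n%:R) = 2 * (C%:R * lam).
    by field; rewrite gt_eqF.
  lra.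
pose f i : {ffun 'I_n -> 'I_(C * n).+1} := [ffun m => inord (Num.truncn (y i m))].
have fE i m : i \in s -> f i m = Num.truncn (y i m) :> nat.
  move=> si; rewrite ffunE inordK // ltnS -(ler_nat R).
  by apply: le_trans (y_le i m si); rewrite Num.Theory.truncn_le y_ge0.
rewrite -(size_map f).
have -> : ((C * n).+1 ^ n)%N = #|{ffun 'I_n -> 'I_(C * n).+1}|.
  by rewrite card_ffun !card_ord.
have /card_uniqP <- : uniq (map f s); last exact: max_card.
rewrite map_inj_in_uniq // => i j si sj fij; apply/eqP; apply: contraT => ij.
have := sep i j si sj ij; rewrite leNgt => /negP[].
apply: le_lt_trans (enorm_le_sum _) _.
have -> : 2 * lam = \sum_(m < n) (2 * lam / n%:R).
  by rewrite sumr_const card_ord -[_ *+ n]mulr_natr divfK // gt_eqF.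
apply: ltr_sum; first by apply/hasP; exists (Ordinal n_gt0) => //; apply: mem_index_enum.
move=> m _; rewrite !mxE.
have /andP[i1 i2] := Num.Theory.truncn_itv (y_ge0 i m si).
have /andP[j1 j2] := Num.Theory.truncn_itv (y_ge0 j m sj).
have E : Num.truncn (y i m) = Num.truncn (y j m) by rewrite -!fE // fij.
have : `|y i m - y j m| < 1.
  by rewrite ltr_norml; move: i1 i2 j1 j2; rewrite E -natr1 => *; apply/andP; split; lra.
have -> : y i m - y j m = (z i ord0 m - z j ord0 m) / (2 * lam / n%:R).
  by rewrite /y -mulrBl; congr (_ / _); ring.
by rewrite normrM normfV [`|2 * _ / _|]gtr0_norm // ltr_pdivrMr // mul1r.
Qed.

(** By the last hypothesis a sphere containing one other contains all others. Two such spheres would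
    contain each other, so removing one leaves mutually exterior spheres. *)
Lemma nonsep_packing (T : eqType) (s : seq T) (c x : T -> 'rV[R]_n)
    (rad : T -> R) (x0 : 'rV[R]_n) (lam : R) (C : nat) : 0 < lam -> uniq s ->
  (forall i, i \in s -> lam <= rad i) ->
  (forall i, i \in s -> enorm (x i - c i) = rad i) ->
  (forall i, i \in s -> forall m, `|x i ord0 m - x0 ord0 m| <= C%:R * lam) ->
  let nested i j := enorm (c i - c j) < rad j - rad i in
  (forall i j, i \in s -> j \in s -> i != j ->
     [\/ nested i j, nested j i | rad i + rad j < enorm (c i - c j)]) ->
  (forall i j k, i \in s -> j \in s -> k \in s -> k != j ->
     nested i j -> nested k j) ->
  (size s <= ((C.+1 * n).+1 ^ n).+1)%N.
Proof.
move=> lam0 us radl xc box nested tri nonsep.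
have ext_case s' : uniq s' -> {subset s' <= s} ->
    (forall i j, i \in s' -> j \in s' -> ~ nested i j) ->
    (size s' <= (C.+1 * n).+1 ^ n)%N.
  move=> us' ss' nn.
  (* The centre of a ball of radius [lam] inside the sphere [i], tangent to it at [x i]; hence
     [C.+1] in place of [C]. *)
  pose z i := x i + (lam / rad i) *: (c i - x i).
  have rp i : i \in s' -> 0 < rad i by move=> /ss' /radl; apply: lt_le_trans.
  have zc i : i \in s' -> enorm (z i - c i) = rad i - lam.
    move=> si; have ri := rp i si.
    have -> : z i - c i = (1 - lam / rad i) *: (x i - c i).
      rewrite scalerBl scale1r /z -[c i - x i]opprB scalerN.
      by rewrite addrAC.
    rewrite enormZ xc ?ss' // ger0_norm ?mulrBl ?mul1r ?divfK ?gt_eqF //.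
    by rewrite subr_ge0 ler_pdivrMr // mul1r radl ?ss'.
  have zx i : i \in s' -> enorm (z i - x i) = lam.
    move=> si; have ri := rp i si.
    rewrite /z addrC addKr enormZ enorm_sub xc ?ss' // ger0_norm ?divfK ?gt_eqF //.
    by rewrite divr_ge0 // ltW.
  apply: (@packing _ s' z x0 lam C.+1) => // [i si m|i j si sj ij].
    have := box i (ss' i si) m; have := coord_le_enorm (z i - x i) m.
    have subE (u v : 'rV[R]_n) : (u - v) ord0 m = u ord0 m - v ord0 m.
      by rewrite !mxE.
    rewrite zx // subE -(natr1 C) => h1 h2.
    have -> : z i ord0 m - x0 ord0 m = (z i ord0 m - x i ord0 m) + (x i ord0 m - x0 ord0 m).
      by ring.
    by apply: le_trans (ler_normD _ _) _; lra.
  have [h|h|h] := tri i j (ss' i si) (ss' j sj) ij.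
  - by case: (nn i j si sj).
  - by case: (nn j i sj si).
  have := enorm_triangle3 (c i) (z i) (c j).
  have := enorm_triangle3 (z i) (z j) (c j).
  rewrite (enorm_sub (c i) (z i)) !zc //.
  have E : enorm (z j - c j) = rad j - lam by apply: zc.
  lra.
have [[i [j [si sj ij]]]|none] := pselect (exists i j, [/\ i \in s, j \in s & nested i j]).
  rewrite (perm_size (perm_to_rem sj)) /= ltnS.
  apply: ext_case; first exact: rem_uniq.
    by move=> k; apply: mem_rem.
  move=> i' j'; rewrite !mem_rem_uniq // !inE => /andP[i'j si'] /andP[j'j sj'] n1.
  have n2 : nested j' j by apply: nonsep ij.
  have n3 : nested j j' by apply: nonsep n1; rewrite // eq_sym.
  move: n2 n3; rewrite /nested (enorm_sub (c j')).
  by have := enorm_ge0 (c j - c j'); lra.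
apply: leqW; apply: ext_case => // i j si sj nij.
by apply: none; exists i, j.
Qed.

End Packing.

(** * Bags of intersection graphs of spheres *)

Section Touch.
Variables (R : realType) (n : nat).
Hypothesis n2 : (2 <= n)%N.
Variables (J : Type) (c : J -> 'rV[R]_n) (rad : J -> R).
Hypothesis rad_gt0 : forall j, 0 < rad j.

Definition on_sphere (j : J) (p : 'rV[R]_n) : Prop := enorm (p - c j) = rad j.

Definition touch (i j : J) : Prop := exists p, on_sphere i p /\ on_sphere j p.

Definition inside (i j : J) : Prop := enorm (c i - c j) < rad j - rad i.

Lemma touch_sym i j : touch i j -> touch j i.
Proof. by case=> p [ip jp]; exists p. Qed.

Lemma touch_refl i : touch i i.
Proof.
have [p [ip _]] : exists p, enorm (p - c i) = rad i /\ enorm (p - c i) = rad i.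
  have ri := rad_gt0 i.
  by apply: spheres_meet => //; rewrite ?subrr ?enorm0 // addr_ge0 // ltW.
by exists p.
Qed.

Lemma touchPn i j : ~ touch i j ->
  [\/ inside i j, inside j i | rad i + rad j < enorm (c i - c j)].
Proof.
move=> nt; rewrite /inside (enorm_sub (c j)).
have [h|h] := ltP (enorm (c i - c j)) (rad j - rad i); first exact: Or31.
have [h'|h'] := ltP (enorm (c i - c j)) (rad i - rad j); first exact: Or32.
have [h''|h''] := ltP (rad i + rad j) (enorm (c i - c j)); first exact: Or33.
case: nt; exact: spheres_meet.
Qed.

(* A sphere that does not meet the sphere [j] lies on one side of it. *)
Lemma inside_touch a b j : touch a b -> ~ touch b j -> inside a j -> inside b j.
Proof.
move=> [p [ap bp]] /touchPn nbj aj; have bp0 := rad_gt0 b; have ap0 := rad_gt0 a.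
have jp0 := rad_gt0 j.
have pj : enorm (p - c j) < rad j.
  apply: le_lt_trans (enorm_triangle3 _ (c a) _) _.
  by rewrite (_ : enorm (p - c a) = rad a) // -ltrBrDl.
case: nbj => // [jb|ext]; move: bp; rewrite /on_sphere => bp.
  by move: jb; rewrite /inside; have := enorm_triangle3 p (c j) (c b); lra.
have := enorm_triangle3 (c b) p (c j); rewrite (enorm_sub _ p); lra.
Qed.

End Touch.

Section Width.
Variables (R : realType) (n : nat).
Hypothesis n2 : (2 <= n)%N.
Variables (J : finType) (c : J -> 'rV[R]_n) (rad : J -> R).
Hypothesis rad_gt0 : forall j, 0 < rad j.

Let tch := touch c rad.
Let nr := near tch.
Let nrP : walk_metric nr.
Proof.
apply: near_walk_metric; first exact: touch_refl.
by move=> i j; apply: touch_sym.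
Qed.

Variables (t K : nat) (ord : J -> nat) (top : J -> J) (s0 : R) (lev : J -> nat).
Hypothesis ord_inj : injective ord.
Hypothesis ord_rad : forall i j, (ord i <= ord j)%N -> rad i <= rad j.
Hypothesis top_near : forall u, nr t u (top u).
Hypothesis top_max : forall u i, nr t u i -> (ord i <= ord (top u))%N.
Let key u := ord (top u).
Let lam u := rad (top u).
Hypothesis s0_gt0 : 0 < s0.
Hypothesis lev_size : forall u,
  cell_size n s0 (lev u) <= n.+2%:R * (K%:R * lam u).
Hypothesis lev_mono : forall u v, lam u <= lam v -> (lev u <= lev v)%N.

(* [top u] is the largest sphere within [t] steps of [u], so every sphere within
   [t] steps lies in the box of half-side [(2t+1) * lam u] around [c u]. *)
Definition centred (a : nat) (u : J) : bool :=
  `[< forall m, cell n s0 a (lev u) (c u ord0 m - (2 * t).+1%:R * lam u) =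
                cell n s0 a (lev u) (c u ord0 m + (2 * t).+1%:R * lam u) >].

Variables (a k : nat).
Hypothesis kt : (k < t)%N.

Let H := near_rel nr k.
Let A : pred J := centred a.

Let lam_gt0 u : 0 < lam u. Proof. exact: rad_gt0. Qed.

Let near_rad u w : nr t u w -> rad w <= lam u.
Proof. by move=> /top_max; apply: ord_rad. Qed.

Let near_le j j' u w : (j <= j')%N -> nr j u w -> nr j' u w.
Proof. exact: wm_le. Qed.

Let near_point j u w p : (j <= t)%N -> nr j u w -> on_sphere c rad w p ->
  enorm (p - c u) <= (2 * j).+1%:R * lam u.
Proof.
move=> jt uw; move: p.
apply: (near_ind (P := fun j w => forall p, on_sphere c rad w p ->
  enorm (p - c u) <= (2 * j).+1%:R * lam u) _ _ uw).
  move=> p ->; rewrite mul1r; apply: near_rad.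
  by apply: (near_le (leq0n t)); apply: wm_refl nrP u.
move=> i w' b ij uw' IH wb p bp.
have ub : nr t u b by apply: (near_le (leq_trans ij jt)); exists w'.
case: (wb) => q [w'q bq]; have := IH q w'q; have := near_rad ub.
have := enorm_triangle3 p q (c u); have := enorm_triangle3 p (c b) q.
rewrite (enorm_sub (c b)) bp bq.
have -> : (2 * i.+1).+1%:R = (2 * i).+1%:R + 2 :> R.
  by rewrite -natrD; congr (_%:R); rewrite mulnS; clear; lia.
by rewrite mulrDl; lra.
Qed.

Let near_centre u w : nr k u w ->
  enorm (c w - c u) <= (2 * t).+1%:R * lam u.
Proof.
move=> uw; have [p [wp _]] := touch_refl n2 c rad_gt0 w.
have := near_point (ltnW kt) uw wp.
have := near_rad (near_le (ltnW kt) uw).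
have := enorm_triangle3 (c w) p (c u); rewrite (enorm_sub (c w) p) wp => h1 h2 h3.
apply: le_trans h1 _.
have : (2 * k).+1%:R + 1 <= (2 * t).+1%:R :> R.
  by rewrite natr1 ler_nat; move: kt; clear; lia.
rewrite -(ler_pM2r (lam_gt0 u)) mulrDl mul1r; lra.
Qed.

Let near_cell u w m : u \in A -> nr k u w ->
  cell n s0 a (lev u) (c w ord0 m) = cell n s0 a (lev u) (c u ord0 m).
Proof.
move=> /asboolP uA /near_centre uw.
have := coord_le_enorm (c w - c u) m; rewrite !mxE => /le_trans/(_ uw).
rewrite ler_norml => /andP[h1 h2].
have lW : 0 <= (2 * t).+1%:R * lam u by rewrite mulr_ge0 // ltW.
move: h1 h2 lW; have := uA m; move: (_ * lam u) => W E h1 h2 lW.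
have E1 : cell n s0 a (lev u) (c w ord0 m) = cell n s0 a (lev u) (c u ord0 m - W).
  by apply: cell_between E => //; lra.
have E2 : cell n s0 a (lev u) (c u ord0 m) = cell n s0 a (lev u) (c u ord0 m - W).
  by apply: cell_between E => //; lra.
by rewrite E1 E2.
Qed.

Let step := key_step A H key.

(** Vertices of key at most [key v] have level at most [lev v]: each step stays in a cell of its own
    level, hence by [cell_nest] in the cell of [v]. *)
Let step_cell v u m : connect (step (key v)) v u ->
  cell n s0 a (lev v) (c u ord0 m) = cell n s0 a (lev v) (c v ord0 m).
Proof.
move: u; apply: connect_last_ind => // b d _ IH.
case/and3P => /and3P[bA dA /asboolP bd] kb kd; rewrite -IH.
apply: cell_nest (near_cell m bA bd) => //.
by apply: lev_mono; apply: ord_rad.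
Qed.

Let low_far v u e y : (key u <= key v)%N -> (key v < ord y)%N ->
  nr k u e -> ~ tch e y.
Proof.
move=> uv vy ue ey; have : nr t u y by apply: near_le kt _; exists e.
by move=> /top_max; apply/negP; rewrite -ltnNge; apply: leq_ltn_trans uv vy.
Qed.

(** On a walk from [w] to [top w], [y] is the first sphere of rank above [key v] and [x] the point
    where the walk meets it. All earlier spheres have radius at most [lam v], so [x] is still close
    to [w]. *)
Let first_above v w : (ord w <= key v)%N -> (key v < key w)%N ->
  exists y x, [/\ nr t w y, (key v < ord y)%N, on_sphere c rad y x &
    enorm (x - c w) <= (2 * t)%:R * lam v].
Proof.
move=> wv vw; have lv := lam_gt0 v.
pose hit := exists y x, [/\ nr t w y, (key v < ord y)%N, on_sphere c rad y x &
    enorm (x - c w) <= (2 * t)%:R * lam v].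
suff : hit \/ (ord (top w) <= key v)%N /\ forall p, on_sphere c rad (top w) p ->
    enorm (p - c w) <= (2 * t).+1%:R * lam v.
  by case=> // -[]; rewrite leqNgt vw.
apply: (near_ind (P := fun j z => hit \/ (ord z <= key v)%N /\
  forall p, on_sphere c rad z p -> enorm (p - c w) <= (2 * j).+1%:R * lam v)
  _ _ (top_near w)).
  right; split=> // p ->; rewrite mul1r; exact: ord_rad.
move=> j b d jt wb [|[bv IH] [q [bq dq]]]; first by left.
have le2 : (2 * j).+1%:R * lam v <= (2 * t)%:R * lam v.
  by rewrite ler_pM2r // ler_nat; move: jt; clear; lia.
have [vd|dv] := ltnP (key v) (ord d).
  left; exists d, q; split=> //; last exact: le_trans (IH q bq) le2.
  by apply: near_le jt _; exists b; split=> //; exists q.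
right; split=> // p dp.
have := IH q bq; have : rad d <= lam v by apply: ord_rad.
have := enorm_triangle3 p q (c w); have := enorm_triangle3 p (c d) q.
rewrite (enorm_sub (c d)) dp dq.
have -> : (2 * j.+1).+1%:R = (2 * j).+1%:R + 2 :> R.
  by rewrite -natrD; congr (_%:R); rewrite mulnS; clear; lia.
by rewrite mulrDl; lra.
Qed.

(** In units of [lam v], the cell of [v] has side at most [N.+2 * L], and the points [x] are within
    [2 * T] of centres in it. One of the two final successors is for the sphere removed in
    [nonsep_packing], the other for the centre [v]. *)
Definition packing_bound (N T L : nat) : nat :=
  (((N.+2 * L + 2 * T).+1 * N).+1 ^ N).+2.

(* Several far apart elements of the bag of [v] lead to pairwise disjoint spheres
   of radius at least [lam v] near the cell of [v]; none of them separates two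
   others, because these are joined by spheres that do not meet it. *)
Lemma thin_tree_centred :
  thin_tree nr A k (2 * t).+1 (packing_bound n t K).
Proof.
have n0 : (0 < n)%N by apply: leq_trans n2.
have Hs : symmetric H.
  by move=> u v; apply/asboolP/asboolP => uv; exact: (wm_sym nrP uv).
have kt2 : (k <= (2 * t).+1)%N by move: kt; clear; lia.
exists J, (key_le A H key), id, (key_bag A H key); split.
  apply: key_tree_dec => // u v _ _ /asboolP; exact: near_le kt2.
move=> v.
pose S := [pred w | [&& w \in A, key_bag A H key w v & (key v < key w)%N]].
pose e := [rel u w : J | `[< nr (2 * t).+1 u w >]].
have [|u w|s [us sS sep net]] := @separated_net _ S e.
- by move=> u; apply/asboolP; apply: near_le (leq0n _) _; apply: wm_refl nrP u.
- by apply/asboolP/asboolP => uv; exact: (wm_sym nrP uv).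
exists (v :: s); split; last first.
  move=> w wA wv; have [vw|wv'] := ltnP (key v) (key w).
    have [x xs /asboolP wx] := net w (introT and3P (And3 wA wv vw)).
    by exists x => //; rewrite inE xs orbT.
  exists v; rewrite ?mem_head //.
  move: wv; rewrite /key_bag ltnNge wv' /= orbF => /andP[kwv kvw].
  have E : top w = top v.
    by apply: ord_inj; apply/eqP; rewrite eqn_leq (key_le_key kwv) (key_le_key kvw).
  apply: (near_le (leqnSn _)); rewrite mul2n -addnn.
  apply: (wm_tri nrP (top_near w)); rewrite E.
  by apply: (wm_sym nrP); apply: top_near.
rewrite /= ltnS.
have data w : w \in s -> exists u, [/\ u \in A, key_le A H key u v, nr k u w &
    (key v < key w)%N].
  move=> /sS/and3P[wA bw vw]; move: bw; rewrite /key_bag.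
  case/orP => [/andP[_ /key_le_key]|]; first by rewrite leqNgt vw.
  by case/andP=> _ /existsP[u /and3P[uA uv /asboolP uw]]; exists u.
have low w : w \in s -> (ord w <= key v)%N.
  move=> /data[u [_ uv uw _]]; apply: leq_trans (key_le_key uv).
  by apply: top_max; apply: near_le (ltnW kt) uw.
have /choice[yx yxP] w : exists yx, w \in s -> 
    [/\ nr t w yx.1, (key v < ord yx.1)%N, on_sphere c rad yx.1 yx.2 &
    enorm (yx.2 - c w) <= (2 * t)%:R * lam v].
  have [ws|] := boolP (w \in s); last by exists (w, 0).
  have [u [_ _ _ vw]] := data w ws.
  by have [y [x h]] := first_above (low w ws) vw; exists (y, x).
pose y w := (yx w).1; pose x w := (yx w).2.
(* The net is separated by more than [2 * t + 1]: [t] steps from [w], one contact, and [t] steps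
   from [y j] to [j]. *)
have far w j e' : w \in s -> j \in s -> w != j -> nr t w e' -> ~ tch e' (y j).
  move=> ws js wj we ej; have := sep w j ws js wj; move/asboolP; apply.
  have [jy _ _ _] := yxP j js.
  have -> : (2 * t).+1 = (t.+1 + t)%N by clear; lia.
  apply: (wm_tri nrP (y := y j)); first by exists e'.
  exact: (wm_sym nrP jy).
have prop_in z m b d : nr m b d -> (forall e', nr m b e' -> ~ tch e' (y z)) ->
    (inside c rad b (y z) <-> inside c rad d (y z)).
  move=> bd nt; suff : nr m b d /\ (inside c rad b (y z) <-> inside c rad d (y z)).
    by case.
  have nt' j e' : (j <= m)%N -> nr j b e' -> ~ tch e' (y z).
    by move=> jm be; apply: nt; apply: near_le be.
  apply: (near_ind (P := fun j d => nr j b d /\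
    (inside c rad b (y z) <-> inside c rad d (y z))) _ _ bd).
    by split=> //; apply: wm_refl nrP b.
  move=> j d' f jm bd' [_ IH] df.
  have bf : nr j.+1 b f by exists d'.
  split=> //; rewrite IH; split; apply: inside_touch => //.
  - exact: nt' bf.
  - exact: touch_sym.
  - exact: nt' (ltnW jm) bd'.
(* Go from [y w] to [w], on to its low neighbour [u], and through spheres of key at most [key v] to
   [v]. None of the spheres passed meets [y z], so the side of [y z] never changes. *)
have up z w : z \in s -> w \in s -> w != z ->
    (inside c rad (y w) (y z) <-> inside c rad v (y z)).
  move=> zs ws wz; have [wy _ _ _] := yxP w ws.
  have [_ vy _ _] := yxP z zs.
  rewrite -(prop_in z t w (y w)) //; last by move=> e'; apply: far.
  have [u [uA uv uw _]] := data w ws.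
  rewrite -(prop_in z k u w) //; last first.
    by move=> e'; apply: low_far vy; apply: key_le_key uv.
  move: u uv {uA uw}; rewrite /key_le; apply: connect_last_ind => // b d _ IH.
  case/and3P => /and3P[bA dA /asboolP bd] kb kd; rewrite -IH.
  by symmetry; apply: prop_in bd _ => e'; apply: low_far vy.
apply: (@nonsep_packing _ _ n0 _ s (c \o y) x (rad \o y) (c v) (lam v)) => //=.
- by move=> w ws; have [_ vy _ _] := yxP w ws; apply: ord_rad; apply: ltnW.
- by move=> w ws; have [_ _ xy _] := yxP w ws.
- move=> w ws m; have [_ _ _ xw] := yxP w ws.
  have [u [uA uv uw _]] := data w ws.
  have E : cell n s0 a (lev v) (c w ord0 m) = cell n s0 a (lev v) (c v ord0 m).
    rewrite -(step_cell m uv); apply: cell_nest (near_cell m uA uw) => //.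
    by apply: lev_mono; apply: ord_rad; apply: key_le_key uv.
  have h1 := le_trans (cell_dist s0_gt0 E) (lev_size v).
  have h2 := le_trans (cell_dist s0_gt0 (esym E)) (lev_size v).
  have := le_trans (coord_le_enorm (x w - c w) m) xw.
  have subE (p q : 'rV[R]_n) : (p - q) ord0 m = p ord0 m - q ord0 m.
    by rewrite !mxE.
  rewrite subE natrD [(n.+2 * K)%:R]natrM mulrDl -mulrA.
  move: h1 h2; move: (n.+2%:R * _) ((2 * t)%:R * lam v) => p q h1 h2.
  by rewrite !ler_norml => /andP[h3 h4]; apply/andP; split; lra.
- move=> i j iS jS ij; apply: (touchPn n2 rad_gt0); apply: (far i) => //.
  by have [] := yxP i iS.
- move=> i j z iS jS zS zj ij.
  have ij' : i != j.
    apply: contraTneq ij => ->; by rewrite !subrr enorm0 ltxx.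
  by apply/(up j z jS zS zj)/(up j i jS iS ij').
Qed.

End Width.

(** Breaking ties between radii makes equal keys mean equal [top], hence distance at most
    [2 * t]. *)
Lemma exists_rank (R : realType) (J : finType) (rad : J -> R) :
  exists ord : J -> nat, injective ord /\
    forall i j, (ord i <= ord j)%N -> rad i <= rad j.
Proof.
pose below j := [pred i | rad i < rad j].
exists (fun j => #|below j| * #|J| + enum_rank j)%N; split=> [i j|i j].
  move=> /(congr1 (modn^~ #|J|)) /=; rewrite !modnMDl !modn_small ?ltn_ord //.
  by move/val_inj/enum_rank_inj.
apply: contraTT; rewrite -ltNge -ltnNge => ji.
have : (#|below j| < #|below i|)%N.
  apply: proper_card; apply/properP; split.
    by apply/fintype.subsetP => z; rewrite !inE => /lt_trans; apply.
  by exists j; rewrite !inE ?ltxx.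
have := ltn_ord (enum_rank j); move: (#|below _|) (#|below _|) => p q.
move: (nat_of_ord _) (nat_of_ord _) => e f; rewrite cardE => *; nia.
Qed.

Lemma exists_scale (R : realType) (J : finType) (rad : J -> R) :
  (forall j, 0 < rad j) -> exists2 s0 : R, 0 < s0 & forall j, s0 <= rad j.
Proof.
move=> rad0; suff [s s0 sP] : exists2 s0 : R, 0 < s0 &
    forall j, j \in enum J -> s0 <= rad j.
  by exists s => // j; apply: sP; rewrite mem_enum.
elim: (enum J) => [|i l [s s0 sP]]; first by exists 1.
exists (Num.min s (rad i)); first by rewrite lt_min s0 rad0.
by move=> j; rewrite inE ge_min => /orP[/eqP ->|/sP ->//]; rewrite lexx orbT.
Qed.

Lemma exists_level (R : realType) (n : nat) (s0 : R) : 0 < s0 ->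
  exists lev : R -> nat, [/\
    forall x, x <= cell_size n s0 (lev x),
    forall x, s0 <= x -> cell_size n s0 (lev x) <= n.+2%:R * x &
    forall x y, x <= y -> (lev x <= lev y)%N].
Proof.
move=> s0p.
have ex x : exists l, x <= cell_size n s0 l.
  exists (Num.bound (x / s0)); rewrite /cell_size mulrC -ler_pdivrMr //.
  apply: le_trans (ltW (upper_nthrootP (leqnn _))) _.
  by rewrite lerXn2r ?nnegrE ?ler_nat.
exists (fun x => ex_minn (ex x)); split=> [x|x sx|x y xy].
- by case: ex_minnP.
- case: ex_minnP => -[|l] hl lmin.
    rewrite /cell_size expr0 mulr1; apply: (le_trans sx).
    by rewrite ler_peMl ?ler1n //; apply: le_trans (ltW s0p) sx.
  have : cell_size n s0 l < x.
    by rewrite ltNge; apply/negP => /lmin; rewrite ltnn.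
  rewrite /cell_size exprS mulrCA => h.
  by rewrite ler_pM2l ?ltr0Sn // ltW.
- case: (ex_minnP (ex y)) => l hl _; case: ex_minnP => l' _; apply.
  exact: le_trans hl.
Qed.

Theorem finite_colouring (R : realType) (n r : nat) : (2 <= n)%N ->
  exists F : nat, forall (J : finType) (c : J -> 'rV[R]_n) (rad : J -> R),
  (forall j, 0 < rad j) ->
  exists col : J -> nat, (forall j, (col j <= n.+1)%N) /\
    forall x y, connect (mono predT (near_rel (near (touch c rad)) r) col) x y ->
      near (touch c rad) F x y.
Proof.
move=> n2.
(* [t] exceeds all the scales [3 ^ a * r] of the merging, and [K] makes a cell large enough for
   [exists_good_shift] with half-width [(2 * t).+1 * lam]. *)
pose t := (3 ^ n.+1 * r).+1; pose K := (2 * (2 * t).+1 * n.+1).+1.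
have [F FP] := thin_tree_colouring (packing_bound n t K) (2 * t).+1 n.+1 r.
exists F => J c rad rad0.
have nrP : walk_metric (near (touch c rad)).
  apply: near_walk_metric; first exact: touch_refl.
  by move=> i j; apply: touch_sym.
have [ord [ord_inj ord_rad]] := exists_rank rad.
have /choice[top topP] u : exists m, near (touch c rad) t u m /\
    forall i, near (touch c rad) t u i -> (ord i <= ord m)%N.
  have uu : `[< near (touch c rad) t u u >].
    by apply/asboolP; apply: (wm_le nrP (leq0n t)); apply: (wm_refl nrP).
  case: (@arg_maxnP _ _ (fun i => `[< near (touch c rad) t u i >]) ord uu).
  move=> m /asboolP um mmax; exists m; split=> // i ui.
  by apply: mmax; apply/asboolP.
have [s0 s0p s0r] := exists_scale rad0.
have [lev0 [lev1 lev2 lev3]] := exists_level n s0p.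
pose lev u := lev0 (K%:R * rad (top u)).
pose A a := centred c rad t top s0 lev a.
have Kp : 0 < K%:R :> R by rewrite ltr0n.
have [] := FP J _ nrP predT A.
- move=> u _; have lp := rad0 (top u).
  have [||a aP] := @exists_good_shift R n s0 s0p (lev u) (fun m => c u ord0 m)
      ((2 * t).+1%:R * rad (top u)).
  + by rewrite mulr_ge0 // ltW.
  + apply: lt_le_trans (lev1 _); rewrite mulrA mulrAC -!natrM ltr_pM2r // ltr_nat.
    by rewrite ltnS.
  by exists a; [apply: ltn_ord | apply/asboolP].
- move=> a an; apply: (thin_tree_centred n2 rad0 ord_inj ord_rad) => //.
  + by move=> u; case: (topP u).
  + by move=> u i; case: (topP u) => _; apply.
  + move=> u; apply: lev2; apply: le_trans (s0r (top u)) _.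
    by rewrite ler_peMl ?ler1n // ltW.
  + by move=> u v uv; apply: lev3; rewrite ler_pM2l.
  + by rewrite ltnS leq_mul2r leq_exp2l // (ltnW an) orbT.
by move=> col [h1 h2]; exists col.
Qed.

(** * Graph distances and compactness *)

Lemma near_path (T : Type) (t : T -> T -> Prop) k x y : near t k x y ->
  exists p : nat -> T, [/\ p 0%N = x, p k = y &
    forall i, (i < k)%N -> t (p i) (p i.+1)].
Proof.
elim: k y => [|k IH] y /=; first by move=> <-; exists (fun=> x).
move=> [z [/IH[p [p0 pk pS]] zy]].
exists (fun i => if (i <= k)%N then p i else y); split=> //.
  by rewrite ltnn.
move=> i; rewrite ltnS => ik; rewrite ik; have [ik'|ki] := ltnP i k.
  exact: pS.
by have -> : i = k; [apply/eqP; rewrite eqn_leq ik | rewrite pk].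
Qed.

Lemma path_near (T : Type) (t : T -> T -> Prop) (p : nat -> T) i k :
  (forall j, (j < k)%N -> t (p (i + j)%N) (p (i + j).+1)) ->
  near t k (p i) (p (i + k)%N).
Proof.
elim: k => [|k IH] pS /=; first by rewrite addn0.
exists (p (i + k)%N); split; last by rewrite addnS; apply: pS.
by apply: IH => j jk; apply: pS; apply: ltnW.
Qed.

Section GraphDistance.
Variables (R : realType) (G : sgraph).
Implicit Types (u v : G).

Definition radj u v : Prop := u = v \/ adj u v.

Lemma radj_metric : walk_metric (near radj).
Proof.
apply: near_walk_metric; first by left.
by move=> u v [->|/adj_sym]; [left|right].
Qed.

Lemma gdist_ge k u v : ~ near radj k u v -> ((k.+1)%:R%:E <= gdist R u v)%E.
Proof.
move=> nuv; apply: le_ereal_inf_tmp => _ [l [p [p0 pl pS _]] <-].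
rewrite lee_fin ler_nat ltnNge; apply/negP => lk; apply: nuv.
apply: (wm_le radj_metric lk); rewrite -p0 -pl.
by apply: (@path_near _ _ _ 0) => j jl; right; apply: pS.
Qed.

(** A shortest walk is a path, since the part between two visits to a vertex could be cut out. *)
Lemma gdist_le k u v : near radj k u v -> (gdist R u v <= k%:R%:E)%E.
Proof.
move=> uvk.
have ex : exists k, `[< near radj k u v >] by exists k; apply/asboolP.
case: (ex_minnP ex) => l /asboolP uvl lmin.
have lk : (l <= k)%N by apply: lmin; apply/asboolP.
have [p [p0 pl pS]] := near_path uvl.
have inj i j : (i < j)%N -> (j <= l)%N -> p i <> p j.
  move=> ij jl pij.
  have h1 : near radj i u (p i).
    rewrite -p0; apply: (@path_near _ _ _ 0) => m mi; apply: pS.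
    by apply: leq_trans jl; apply: ltn_trans mi ij.
  have h2 : near radj (l - j) (p j) v.
    rewrite -pl -{2}(subnKC jl); apply: path_near => m ml; apply: pS.
    by rewrite -ltn_subRL.
  have := lmin (i + (l - j))%N; rewrite leqNgt -ltnS => /(_ _)/negP; apply.
    by apply/asboolP; apply: (wm_tri radj_metric h1); rewrite pij.
  by move: ij jl; clear; lia.
apply: ge_ereal_inf; exists l%:R%:E; last by rewrite lee_fin ler_nat.
exists l => //; exists p; split=> // [i il|i j il jl pij].
  by case: (pS i il) => // E; case: (inj i i.+1).
have [ij|ji|//] := ltngtP i j; first by case: (inj i j ij jl).
by case: (inj j i ji il).
Qed.

End GraphDistance.

Section Compactness.
Variables (I : choiceType) (t : I -> I -> Prop) (N F r : nat).

Let sub (s : seq I) (i j : seq_sub s) : Prop := t (val i) (val j).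

Hypothesis finite_col : forall s : seq I, exists col : seq_sub s -> nat,
  (forall j, (col j <= N)%N) /\
  forall x y, connect (mono predT (near_rel (near (@sub s)) r) col) x y ->
    near (@sub s) F x y.

(** Colours are limits along the ultrafilter. A monochromatic chain involves finitely many vertices,
    so some finite [s] contains it with the same colours, and there the bound [F] holds. *)
Theorem compact_colouring : exists col : I -> nat, (forall x, (col x <= N)%N) /\
  forall m x y, near (fun a b => col a = col b /\ near t r a b) m x y ->
    near t F x y.
Proof.
pose cs s := projT1 (cid (finite_col s)).
have csP s := projT2 (cid (finite_col s)).
pose colour s x := if insub x is Some j then cs s j else 0%N.
pose above : set (set (seq I)) := [set P : set (seq I) | exists s0 : seq I,
  forall s : seq I, {subset s0 <= s} -> P s].
have above_filter : ProperFilter above.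
  split; first by move=> [s0 /(_ s0)]; apply.
  split; first by exists [::].
  - move=> P Q [s1 h1] [s2 h2]; exists (s1 ++ s2) => s h; split.
      by apply: h1 => x xs; apply: h; rewrite mem_cat xs.
    by apply: h2 => x xs; apply: h; rewrite mem_cat xs orbT.
  - by move=> P Q PQ [s0 h]; exists s0 => s /h /PQ.
have [U [UU aboveU]] := ultraFilterLemma above_filter.
have UF : Filter U by apply: filter_filter.
have mem_U (x : I) : U [set s : seq I | x \in s].
  by apply: aboveU; exists [:: x] => s; apply; rewrite mem_head.
have colour_le (s : seq I) (x : I) : (colour s x <= N)%N.
  by rewrite /colour; case: insub => // j; apply: (csP s).1.
have /choice[col colP] x : exists i, (i <= N)%N /\ U [set s : seq I | colour s x = i].
  apply: contrapT => none.
  have : forall k, (k <= N)%N -> U [set s : seq I | (k < colour s x)%N].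
    have ne k : (k <= N)%N -> U [set s : seq I | colour s x <> k].
      move=> kN; have [h|//] := in_ultra_setVsetC [set s : seq I | colour s x = k] UU.
      by case: none; exists k.
    elim=> [|k IH] kN.
      by apply: filterS (ne 0%N kN) => s /=; rewrite lt0n => /eqP.
    apply: filterS2 (IH (ltnW kN)) (ne k.+1 kN) => s /= h1 h2.
    by rewrite ltn_neqAle eq_sym h1 andbT; apply/eqP.
  move/(_ N (leqnn N)) => /filter_ex[s /=].
  by rewrite ltnNge colour_le.
exists col; split=> [x|m x y xy]; first by case: (colP x).
have colourE s z (zs : z \in s) : colour s z = cs s (SeqSub zs).
  by rewrite /colour (insubT (fun z => z \in s) zs).
(* Distances inside [s] can be larger than in [I], so [s] must also contain the inner vertices of
   the walk. *)
have near_U k a b : near t k a b ->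
    U [set s : seq I | exists (sa : a \in s) (sb : b \in s),
         near (@sub s) k (SeqSub sa) (SeqSub sb)].
  elim: k b => [|k IH] b /=.
    by move=> <-; apply: filterS (mem_U a) => s sa; exists sa, sa.
  move=> [z [/IH az zb]]; apply: filterS2 az (mem_U b) => s [sa [sz h]] sb.
  by exists sa, sb, (SeqSub sz).
have : U [set s : seq I | exists (sx : x \in s) (sy : y \in s),
    connect (mono predT (near_rel (near (@sub s)) r) (cs s)) (SeqSub sx) (SeqSub sy)].
  elim: m y xy => [|m IH] y /=.
    by move=> <-; apply: filterS (mem_U x) => s sx; exists sx, sx; apply: connect0.
  move=> [z [/IH xz [czy /near_U zy]]].
  have UI := @filterI _ U UF.
  apply: filterS (UI _ _ (UI _ _ xz zy) (UI _ _ (colP z).2 (colP y).2)).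
  move=> s [[[sx [sz h1]] [sz' [sy h2]]] [cz cy]].
  exists sx, sy; apply: (connect_trans h1); apply: connect1.
  have E : SeqSub sz = SeqSub sz' by apply: val_inj.
  rewrite /mono /near_rel /= E; apply/andP; split; last exact/asboolP.
  by rewrite -!colourE cz cy czy.
move=> /filter_ex[s [sx [sy]]] /((csP s).2).
exact: (near_map (f := val)).
Qed.

End Compactness.

Lemma sphere_setE (R : realType) (n : nat) (c : 'rV[R]_n) (r : R) :
  (0 < n)%N -> 0 < r ->
  boundary (closed_ball_ (@enorm R n) c r) = [set x | enorm (x - c) = r].
Proof.
move=> n0 r0; have np : 0 < n%:R :> R by rewrite ltr0n.
have small d (x y : 'rV[R]_n) : 0 < d -> ball x (d / n%:R) y -> enorm (x - y) < d.
  move=> d0 xy; apply: le_lt_trans (enorm_le_sum _) _.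
  have -> : d = \sum_(m < n) (d / n%:R).
    by rewrite sumr_const card_ord -[_ *+ n]mulr_natr divfK // gt_eqF.
  apply: ltr_sum; first by apply/hasP; exists (Ordinal n0) => //; apply: mem_index_enum.
  by move=> m _; have [_ /(_ ord0 m)] := xy; rewrite /ball /= !mxE.
rewrite predeqE => x; split=> [[xc xi]|/= xr].
  apply/eqP; rewrite /= eq_le; apply/andP; split.
    rewrite leNgt; apply/negP => rx.
    have d0 : 0 < enorm (x - c) - r by rewrite subr_gt0.
    have [y [/= yc /small xy]] := xc _ (nbhsx_ballx x _ (divr_gt0 d0 np)).
    have := xy d0; have := enorm_triangle3 x y c; rewrite (enorm_sub y) => h1 h2.
    by move: yc; rewrite /closed_ball_ /=; lra.
  rewrite leNgt; apply/negP => xr; apply: xi.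
  have d0 : 0 < r - enorm (x - c) by rewrite subr_gt0.
  apply/nbhs_ballP; exists ((r - enorm (x - c)) / n%:R) => /=.
    exact: divr_gt0.
  move=> y /small xy; rewrite /closed_ball_ /=.
  have := xy d0; have := enorm_triangle3 c x y; rewrite (enorm_sub c x); lra.
split.
  by apply: subset_closure; rewrite /closed_ball_ /= enorm_sub xr.
move=> /nbhs_ballP[e /= e0 sub].
(* Moves [x] radially outwards by [e / 2]: inside the neighbourhood, outside the closed ball. *)
pose s := e / (2 * r); have s0 : 0 < s by rewrite divr_gt0 // mulr_gt0.
have : closed_ball_ (@enorm R n) c r (x + s *: (x - c)).
  apply: sub; split=> // i j; rewrite ord1 /ball /= !mxE opprD addrA subrr sub0r normrN.
  rewrite normrM gtr0_norm //; have := coord_le_enorm (x - c) j; rewrite !mxE xr.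
  rewrite -(ler_pM2l s0) => h; apply: le_lt_trans h _.
  by rewrite /s invfM mulrA mulfVK ?gt_eqF // ltr_pdivrMr // ltr_pMr // ltr1n.
rewrite /closed_ball_ /= enorm_sub addrAC.
have -> : x - c + s *: (x - c) = (1 + s) *: (x - c) by rewrite scalerDl scale1r.
have s1 : 0 <= 1 + s by rewrite addr_ge0 // ltW.
rewrite enormZ xr ger0_norm // mulrDl mul1r; have := mulr_gt0 s0 r0; lra.
Qed.

Lemma is_sphereP (R : realType) (n : nat) (S : set 'rV[R]_n) : (0 < n)%N ->
  is_sphere S -> exists c r, 0 < r /\ S = [set x | enorm (x - c) = r].
Proof. by move=> n0 [c [r [r0 ->]]]; exists c, r; rewrite sphere_setE. Qed.

Section MonoChains.
Variables (T : Type) (t : T -> T -> Prop) (col : T -> nat) (r : nat).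
Hypothesis tP : walk_metric (near t).

Lemma mono_chain_metric :
  walk_metric (near (fun a b => col a = col b /\ near t r a b)).
Proof.
apply: near_walk_metric => [x|x y [-> xy]]; split=> //.
  exact: wm_le (leq0n r) (wm_refl tP x).
exact: (wm_sym tP).
Qed.
End MonoChains.

(** The cover consists of the monochromatic [r]-components; two of the same colour at distance at
    most [r] would be one. *)
Lemma colouring_control (R : realType) (G : sgraph) (N F r : nat)
    (col : G -> nat) : (forall x, (col x <= N)%N) ->
  (forall m x y, near (fun a b => col a = col b /\ near (@radj G) r a b) m x y ->
    near (@radj G) F x y) ->
  exists UU : 'I_N.+1 -> set (set G),
    [/\ \bigcup_i \bigcup_(U in UU i) U = setT,
        forall i U, UU i U -> (diam (@gdist R G) U <= F%:R%:E)%E &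
        forall i, rdisjoint (@gdist R G) r%:R (UU i)].
Proof.
move=> colN colF; have MP := mono_chain_metric col r (radj_metric G).
pose M := near (fun a b => col a = col b /\ near (@radj G) r a b).
have M_col m x y : M m x y -> col y = col x.
  move=> xy; apply: (near_ind (P := fun _ z => col z = col x) _ _ xy) => //.
  by move=> j a b _ _ <- [].
pose comp x := [set y | exists m, M m x y].
pose UU (i : 'I_N.+1) := [set U | exists x, col x = i :> nat /\ U = comp x].
exists UU; split.
- rewrite predeqE => x; split=> // _.
  have cx : (col x < N.+1)%N by rewrite ltnS.
  exists (Ordinal cx) => //; exists (comp x); first by exists x.
  by exists 0%N; apply: wm_refl MP x.
- move=> i _ [x [_ ->]]; apply: ge_ereal_sup => _ [[y z] [/= [m xy] [m' xz]] <-].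
  apply: gdist_le; apply: (colF (m + m')%N).
  exact: (wm_tri MP (wm_sym MP xy) xz).
move=> i _ _ [x [cx ->]] [x' [cx' ->]] xx'.
apply: (@lt_le_trans _ _ (r.+1%:R%:E)); first by rewrite lte_fin ltr_nat.
apply: le_ereal_inf_tmp => _ [[y z] [/= [m xy] [m' xz]] <-].
apply: gdist_ge => yz; apply: xx'.
have My1z : M 1%N y z.
  by exists y; split=> //; rewrite (M_col _ _ _ xy) (M_col _ _ _ xz) cx cx'.
have [k xx'] : exists k, M k x x'.
  by exists (m + 1 + m')%N; apply: (wm_tri MP (wm_tri MP xy My1z) (wm_sym MP xz)).
rewrite predeqE => w; split=> -[l lw].
  by exists (k + l)%N; apply: (wm_tri MP (wm_sym MP xx') lw).
by exists (k + l)%N; apply: (wm_tri MP xx' lw).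
Qed.

Lemma near_sphere_graph (R : realType) (n : nat) (I : Type)
    (A : I -> set 'rV[R]_n) (c : I -> 'rV[R]_n) (rad : I -> R) : (2 <= n)%N ->
  (forall i, 0 < rad i) -> (forall i, A i = [set x | enorm (x - c i) = rad i]) ->
  near (@radj (intersection_graph A)) = near (touch c rad).
Proof.
move=> n2 rad0 AE; congr near; apply/funext => i; apply/funext => j.
have touchE k l : touch c rad k l <-> A k `&` A l !=set0.
  by rewrite !AE; split=> -[p pkl]; exists p.
apply/propext; split=> [[->|[_ /touchE //]]|ij]; first exact: touch_refl.
by have [->|ne] := pselect (i = j); [left|right; split=> //; apply/touchE].
Qed.

Theorem asdim_upper (R : realType) (n : nat) : (2 <= n)%N ->
  asdim_at_most R (sphere_graphs R n) n.+1.
Proof.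
move=> n2; have n0 : (0 < n)%N by apply: leq_trans n2.
have [F FP] := choice (fun r => @finite_colouring R n r n2).
exists (fun x : {nonneg R} => ((F (Num.truncn x%:num))%:R)%:nng).
move=> _ [I [A [sph ->]]] r r0.
have [c [rad cr]] : exists (c : I -> 'rV[R]_n) (rad : I -> R),
    forall i, 0 < rad i /\ A i = [set x | enorm (x - c i) = rad i].
  have /choice[c /choice[rad cr]] i := is_sphereP n0 (sph i).
  by exists c, rad.
have rad0 i : 0 < rad i by case: (cr i).
have [|col [colN colF]] := @compact_colouring {classic I} (touch c rad) n.+1 (F r) r.
  move=> s; have [|col [h1 h2]] := FP r (seq_sub s) (fun j => c (val j)) (fun j => rad (val j)).
    by move=> j; apply: rad0.
  by exists col.
have tE := near_sphere_graph n2 rad0 (fun i => (cr i).2).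
rewrite /= natrK.
by apply: (@colouring_control R (intersection_graph A)) colN _; rewrite tE.
Qed.

(** * A discrete Poincare-Miranda theorem *)

Section PoincareMiranda.
Variables (n N : nat).

Definition lattice := 'I_n -> nat.

Definition up (a : 'I_n) (x : lattice) : lattice := fun i => (x i + (i == a))%N.

Definition upd (a : 'I_n) (k : nat) (x : lattice) : lattice :=
  fun i => if i == a then k else x i.

Lemma upC a b x : up a (up b x) = up b (up a x).
Proof. by apply/funext => i; rewrite /up -!addnA [((i == b) + _)%N]addnC. Qed.

Lemma F2_addrr (u : 'F_2) : u + u = 0.
Proof. by apply: val_inj => /=; case: u => -[|[|[]]]. Qed.

Definition diff (a : 'I_n) (g : lattice -> 'F_2) (x : lattice) : 'F_2 :=
  g (up a x) + g x.

(* The cup product of the coboundaries of the functions of the list, evaluated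
   at the cube with lowest corner [x] and set of directions [S]. *)
Fixpoint cup (fs : seq (lattice -> 'F_2)) (S : {set 'I_n}) (x : lattice) : 'F_2 :=
  if fs is f :: fs' then
    \sum_(b in S) diff b f x * cup fs' (S :\ b) (up b x)
  else 1.

Lemma diffC a b g x : diff a (diff b g) x = diff b (diff a g) x.
Proof. by rewrite /diff upC addrACA. Qed.

Lemma sum_sym_pairs (S : {set 'I_n}) (F : 'I_n -> 'I_n -> 'F_2) :
  (forall a b, F a b = F b a) ->
  \sum_(a in S) \sum_(b in S :\ a) F a b = 0.
Proof.
move=> Fsym.
have E : \sum_(a in S) \sum_(b in S :\ a) F a b =
  \sum_(a in S) \sum_(b in S | (b < a)%N) F a b +
  \sum_(a in S) \sum_(b in S | (a < b)%N) F a b.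
  rewrite -big_split; apply: eq_bigr => a aS /=.
  rewrite (bigID (fun b : 'I_n => (b < a)%N)) /=; congr (_ + _); apply: eq_bigl => b.
    by rewrite !inE; case: (eqVneq b a) => [->|_] //=; rewrite ltnn andbF.
  rewrite !inE -leqNgt; case: (eqVneq b a) => [->|ba] /=; first by rewrite ltnn andbF.
  by rewrite [(a < b)%N]ltn_neqAle eq_sym (inj_eq val_inj) ba.
rewrite E [X in X + _](exchange_big_dep (mem S)) //=; last by move=> a b _ /andP[].
rewrite [X in X + _](_ : _ = \sum_(a in S) \sum_(b in S | (a < b)%N) F a b) ?F2_addrr //.
apply: eq_bigr => b bS; apply: eq_big => [a|a _]; last exact: Fsym.
by rewrite bS.
Qed.

(** Leibniz rule: the terms with a second difference of [f] are symmetric in the two directions and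
    cancel in pairs mod 2; the others vanish by induction on the list. *)
Lemma cup_closed fs (S : {set 'I_n}) x : \sum_(a in S) diff a (cup fs (S :\ a)) x = 0.
Proof.
elim: fs S x => [|f fs IH] S x /=.
  by apply: big1 => a _; rewrite /diff F2_addrr.
pose F a b := diff a (diff b f) x * cup fs (S :\ a :\ b) (up a (up b x)).
pose G a b := diff b f x * diff a (cup fs (S :\ b :\ a)) (up b x).
have S2 a b : S :\ a :\ b = S :\ b :\ a.
  by apply/setP => i; rewrite !inE andbCA.
transitivity (\sum_(a in S) \sum_(b in S :\ a) (F a b + G a b)).
  apply: eq_bigr => a _; rewrite {1}/diff -big_split; apply: eq_bigr => b _ /=.
  rewrite /F /G (S2 b a) /diff (upC b a).
  move: (f _) (f _) (f _) (f _) (cup _ _ _) (cup _ _ _) => p q r s u v.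
  rewrite -[LHS]addr0 -[X in _ + X](F2_addrr ((q + p) * v)); ring.
under eq_bigr do rewrite big_split.
rewrite big_split /= sum_sym_pairs ?add0r; last first.
  by move=> a b; rewrite /F diffC S2 upC.
rewrite (exchange_big_dep (mem S)) /=; last by move=> a b _; rewrite inE => /andP[].
apply: big1 => b bS.
rewrite (eq_bigl (mem (S :\ b))).
  by rewrite -big_distrr /= IH mulr0.
by move=> a; rewrite !inE bS andbT andbC eq_sym.
Qed.

Lemma cup_face f fs (S : {set 'I_n}) x b (v : 'F_2) (k : nat) : List.In f fs -> b \notin S ->
  (forall y, y b = k -> f y = v) -> x b = k -> cup fs S x = 0.
Proof.
move=> + + fk; elim: fs S x => //= g fs IH S x gf bS xb.
apply: big1 => c cS; have cb : c != b by apply: contraNneq bS => <-.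
have uxb : up c x b = k by rewrite /up eq_sym (negPf cb) addn0.
case: gf => [->|gf]; first by rewrite /diff !fk // F2_addrr mul0r.
by rewrite IH ?mulr0 // inE negb_and bS orbT.
Qed.

Lemma cup_const f fs (S : {set 'I_n}) x (v : 'F_2) : List.In f fs ->
  (forall y, (forall i, x i <= y i <= x i + (i \in S))%N -> f y = v) ->
  cup fs S x = 0.
Proof.
elim: fs S x => //= g fs IH S x gf fv.
have up_le c i y : c \in S -> (up c x i <= y i <= up c x i + (i \in S :\ c))%N ->
    (x i <= y i <= x i + (i \in S))%N.
  move=> cS; rewrite /up !inE; case: eqVneq => [->|_] /=; first by rewrite cS; lia.
  by lia.
apply: big1 => c cS; case: gf => [->|gf].
  rewrite /diff !fv ?F2_addrr ?mul0r // => i; first by rewrite leqnn leq_addr.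
  by rewrite /up; case: eqVneq => [->|_] /=; rewrite ?cS; lia.
by rewrite IH ?mulr0 // => y yP; apply: fv => i; apply: (up_le c).
Qed.

Fixpoint box_sum (s : seq 'I_n) (G : lattice -> 'F_2) (x : lattice) : 'F_2 :=
  if s is a :: s' then \sum_(k < N) box_sum s' G (upd a k x) else G x.

Lemma box_sumD s G G' x :
  box_sum s (fun y => G y + G' y) x = box_sum s G x + box_sum s G' x.
Proof.
elim: s x => //= a s IH x; rewrite -big_split; apply: eq_bigr => k _; exact: IH.
Qed.

Lemma box_sum_sum (I : finType) (P : pred I) s (G : I -> lattice -> 'F_2) x :
  box_sum s (fun y => \sum_(i | P i) G i y) x = \sum_(i | P i) box_sum s (G i) x.
Proof.
elim: s x => //= a s IH x; rewrite exchange_big; apply: eq_bigr => k _; exact: IH.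
Qed.

Lemma box_sum_up s G a k x : a \notin s ->
  box_sum s (fun y => G (up a y)) (upd a k x) = box_sum s G (upd a k.+1 x).
Proof.
have updC b l m (y : lattice) : b != a -> upd b l (upd a m y) = upd a m (upd b l y).
  move=> ba; apply/funext => i; rewrite /upd.
  by case: (eqVneq i b) => // ->; rewrite (negPf ba).
elim: s x => [|b s IH] x /=.
  move=> _; congr G; apply/funext => i; rewrite /up /upd.
  by case: eqVneq => _; rewrite ?addn1 ?addn0.
rewrite inE negb_or eq_sym => /andP[ba sa]; apply: eq_bigr => l _.
by rewrite !updC // IH.
Qed.

Lemma box_sum_eq s G G' x a k : a \notin s -> x a = k ->
  (forall y, y a = k -> G y = G' y) -> box_sum s G x = box_sum s G' x.
Proof.
move=> + + GG; elim: s x => [|b s IH] x /=; first by move=> _ /GG.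
rewrite inE negb_or => /andP[ab sa] xk; apply: eq_bigr => l _; apply: IH => //.
by rewrite /upd (negPf ab).
Qed.

Lemma box_sum0 s x : box_sum s (fun=> 0) x = 0.
Proof. by elim: s x => //= a s IH x; apply: big1 => k _. Qed.

Lemma box_sum_diff_head a s G x : a \notin s ->
  box_sum (a :: s) (diff a G) x =
  box_sum s G (upd a N x) + box_sum s G (upd a 0 x).
Proof.
move=> sa /=.
rewrite (eq_bigr (fun k : 'I_N => box_sum s G (upd a k.+1 x) +
  box_sum s G (upd a k x))); last first.
  by move=> k _; rewrite -box_sum_up // -box_sumD.
elim: N => [|M IH]; first by rewrite big_ord0 F2_addrr.
rewrite big_ord_recr /= IH [X in X + _]addrC -addrA.
by rewrite [X in _ + X]addrCA F2_addrr addr0 addrC.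
Qed.

Lemma box_sum_diff0 s b G x : uniq s -> b \in s ->
  (forall y, y b = 0%N \/ y b = N -> G y = 0) -> box_sum s (diff b G) x = 0.
Proof.
move=> + + G0; elim: s x => // a s IH x /andP[sa us].
rewrite inE; have [ab _|ba /= bs] := eqVneq b a.
  rewrite -ab in sa *; have upb k : upd b k x b = k by rewrite /upd eqxx.
  rewrite box_sum_diff_head //.
  rewrite !(box_sum_eq sa (upb _) (G' := fun=> 0)) ?box_sum0 ?addr0 // => y yb.
    by apply: G0; left.
  by apply: G0; right.
by apply: big1 => k _; apply: IH.
Qed.

(** By [cup_closed] the product is the coboundary of [f a] times the product of the rest, so its sum
    lives on the faces of the box. Faces in a direction other than [a] give 0 as some factor is
    constant there, the face 0 of direction [a] gives 0 as [f a] vanishes, and the face [N] is the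
    induction hypothesis. *)
Lemma box_sum_cup (f : 'I_n -> lattice -> 'F_2) (s : seq 'I_n) x :
  (forall a x, x a = 0%N -> f a x = 0) -> (forall a x, x a = N -> f a x = 1) ->
  uniq s -> box_sum s (cup [seq f a | a <- s] [set a in s]) x = 1.
Proof.
move=> f0 f1; elim: s x => // a s IH x; rewrite cons_uniq => /andP[sa us].
pose S := [set c in a :: s]; pose fs := [seq f a | a <- s].
pose G b y := f a y * cup fs (S :\ b) y.
have cupE y : cup (f a :: fs) S y = \sum_(b in S) diff b (G b) y.
  transitivity (\sum_(b in S) diff b (G b) y +
      f a y * \sum_(b in S) diff b (cup fs (S :\ b)) y); last first.
    by rewrite cup_closed mulr0 addr0.
  rewrite big_distrr /= -big_split /=; apply: eq_bigr => b _.
  rewrite /G /diff; move: (f _ _) (f _ _) (cup _ _ _) (cup _ _ _) => p q u v.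
  rewrite -[LHS]addr0 -[X in _ + X](F2_addrr (p * u)); ring.
change (box_sum (a :: s) (cup (f a :: fs) S) x = 1); rewrite (funext cupE).
have Sa : S :\ a = [set c in s].
  apply/setP => c; rewrite !inE; case: eqVneq => // ->.
  by rewrite (negPf sa).
rewrite box_sum_sum (bigD1 a) /=; last by rewrite !inE eqxx.
rewrite -[X in X + _]/(box_sum (a :: s) (diff a (G a)) x) box_sum_diff_head //.
have upa k : upd a k x a = k by rewrite /upd eqxx.
rewrite (box_sum_eq sa (upa N) (G' := cup fs [set c in s])); last first.
  by move=> y ya; rewrite /G f1 // mul1r Sa.
rewrite IH // (box_sum_eq sa (upa 0%N) (G' := fun=> 0)); last first.
  by move=> y ya; rewrite /G f0 // mul0r.
rewrite box_sum0 addr0 big1 ?addr0 // => b /andP[bS ba].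
have bs : b \in s by move: bS; rewrite !inE (negPf ba).
apply: (@box_sum_diff0 (a :: s)) => /=; rewrite ?sa ?inE ?bs ?orbT //.
have bfs : List.In (f b) fs.
  rewrite /fs; elim: (s) bs => //= c l IHl; rewrite inE => /orP[/eqP ->|/IHl]; by [left|right].
have bSb : b \notin S :\ b by rewrite !inE eqxx.
move=> y [yb|yb]; rewrite /G.
  by rewrite (cup_face bfs bSb (f0 b) yb) mulr0.
by rewrite (cup_face bfs bSb (f1 b) yb) mulr0.
Qed.

Lemma box_sum_nz s G x : box_sum s G x <> 0 ->
  exists2 y, G y <> 0 & forall i, y i = x i \/ (y i < N)%N /\ i \in s.
Proof.
elim: s x => [|a s IH] x /=; first by exists x => // i; left.
move=> nz; have [k /IH[y Gy yP]] : exists k : 'I_N, box_sum s G (upd a k x) <> 0.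
  by apply: contrapT => none; apply: nz; apply: big1 => k _;
    apply: contrapT => ?; apply: none; exists k.
exists y => // i; have [->|[yN si]] := yP i; last first.
  by right; rewrite inE si orbT.
rewrite /upd inE; case: eqVneq => [->|_]; last by left.
by right; rewrite ltn_ord.
Qed.

(* The sum of all cup products over the box is [1] by Stokes, so some cube has a
   nonzero cup product, and no [f a] is constant on it. *)
Theorem poincare_miranda (f : 'I_n -> lattice -> 'F_2) : (0 < N)%N ->
  (forall a x, x a = 0%N -> f a x = 0) -> (forall a x, x a = N -> f a x = 1) ->
  exists x : lattice, (forall i, (x i < N)%N) /\
    forall a v, exists2 y : lattice,
      (forall i, x i <= y i <= (x i).+1)%N & f a y <> v.
Proof.
move=> N0 f0 f1.
have := box_sum_cup (fun=> 0%N) f0 f1 (enum_uniq 'I_n).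
move=> E; have [|x Gx xP] := @box_sum_nz (enum 'I_n)
    (cup [seq f a | a <- enum 'I_n] [set a in enum 'I_n]) (fun=> 0%N).
  by rewrite E; apply/eqP; rewrite oner_eq0.
exists x; split=> [i|a v]; first by have [->|[]] := xP i.
apply: contrapT => none; apply: Gx.
apply: (@cup_const (f a) _ _ _ v) => [|y yP].
  have : a \in enum 'I_n by rewrite mem_enum.
  by elim: (enum 'I_n) => //= c l IHl; rewrite inE => /orP[/eqP ->|/IHl]; [left|right].
apply: contrapT => fy; apply: none; exists y => // i.
by have := yP i; rewrite !inE mem_enum inE addn1.
Qed.

End PoincareMiranda.

(** * The lower bound *)

Section Grid.
Variables (R : realType) (n : nat).
Hypothesis n2 : (2 <= n)%N.

(* The index type is in [Set] for universe reasons; only the first [n] values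
   of [x] matter, so that each sphere of the grid is repeated. *)
Definition grid_centre (x : nat -> nat) : 'rV[R]_n := \row_i (x i)%:R.

Definition grid_radius (x : nat -> nat) : R := 2^-1.

Definition grid_sphere (x : nat -> nat) : set 'rV[R]_n :=
  boundary (closed_ball_ (@enorm R n) (grid_centre x) 2^-1).

Let gt := touch grid_centre grid_radius.

Let half_gt0 x : 0 < grid_radius x. Proof. by rewrite invr_gt0. Qed.

Let gtP : walk_metric (near gt).
Proof.
apply: near_walk_metric; first exact: touch_refl.
by move=> i j; apply: touch_sym.
Qed.

Lemma near_grid_graph :
  near (@radj (intersection_graph grid_sphere)) = near gt.
Proof.
apply: near_sphere_graph => // x; apply: sphere_setE; first exact: leq_trans n2.
by rewrite invr_gt0.
Qed.

Lemma near_grid_coord k (x y : nat -> nat) : near gt k x y -> forall i : 'I_n, (x i <= y i + k)%N.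
Proof.
move=> xy i; apply: (near_ind (P := fun k (y : nat -> nat) => (x i <= y i + k)%N) _ _ xy).
  by rewrite addn0.
move=> j a b _ _ xa [p [ap bp]]; apply: leq_trans xa _.
rewrite addnS -addSn leq_add2r -(ler_nat R) -natr1.
have := coord_le_enorm (grid_centre a - grid_centre b) i; rewrite !mxE => h.
have := le_trans h (enorm_triangle3 _ p _); rewrite (enorm_sub _ p) ap bp.
by rewrite /grid_radius ler_norml => /andP[_]; lra.
Qed.

Lemma touch_same (x y : nat -> nat) : (forall i : 'I_n, x i = y i) -> gt x y.
Proof.
move=> xy; have -> : gt x y = gt x x.
  have cE : grid_centre y = grid_centre x by apply/rowP => i; rewrite !mxE xy.
  by rewrite /gt /touch /on_sphere cE.
exact: touch_refl.
Qed.

Lemma touch_up (a : 'I_n) (x y : nat -> nat) : y a = (x a).+1 ->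
  (forall i : 'I_n, i != a -> y i = x i) -> gt x y.
Proof.
move=> ya yi; apply: spheres_meet => //; rewrite ?subrr ?enorm_ge0 // enorm_sub.
have -> : grid_centre y - grid_centre x = delta_mx ord0 a.
  apply/rowP => i; rewrite !mxE eqxx /=; have [->|ia] := eqVneq i a.
    by rewrite ya -natr1 addrAC subrr add0r.
  by rewrite yi // subrr.
by rewrite enorm_delta /grid_radius; lra.
Qed.

(** One step per coordinate, and a last one because [z n] and [y] may differ beyond the first [n]
    values. *)
Lemma near_cube (x y : nat -> nat) :
  (forall i : 'I_n, (x i <= (y i).+1)%N /\ (y i <= (x i).+1)%N) ->
  near gt n.+1 x y.
Proof.
move=> xy; pose z k (i : nat) := if (i < k)%N then y i else x i.
have zP k : (k <= n)%N -> near gt k x (z k).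
  elim: k => [_|k IH kn].
    have -> : z 0%N = x by apply/funext.
    exact: wm_refl gtP x.
  exists (z k); split; first exact: IH (ltnW kn).
  pose a : 'I_n := Ordinal kn; have [xa ya] := xy a.
  have zE (i : 'I_n) : i != a -> z k.+1 i = z k i.
    by move=> ia; rewrite /z ltnS leq_eqVlt -[(i == k :> nat)]/(i == a) (negPf ia).
  have zk : z k a = x a by rewrite /z ltnn.
  have zk1 : z k.+1 a = y a by rewrite /z ltnSn.
  have [lt|gt'|E] := ltngtP (x a) (y a).
  - apply: (@touch_up a) => [|i]; last exact: zE.
    by rewrite zk zk1; clear -lt ya; lia.
  - apply: touch_sym; apply: (@touch_up a) => [|i /zE //].
    by rewrite zk zk1; clear -gt' xa; lia.
  - apply: touch_same => i; have [->|/zE //] := eqVneq i a.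
    by rewrite zk zk1.
by exists (z n); split; [apply: zP | apply: touch_same => i; rewrite /z ltn_ord].
Qed.

Theorem asdim_lower m : asdim_at_most R (sphere_graphs R n) m -> (n <= m)%N.
Proof.
move=> [f fP]; rewrite leqNgt; apply/negP => mn.
pose G := intersection_graph grid_sphere.
have gE : near (@radj G) = near gt := near_grid_graph.
(* By [near_cube], [n.+1] bounds the distance between cubes that share a corner. *)
have [|UU [cov diamU disj]] := fP G _ n.+1 isT.
  exists (nat -> nat), grid_sphere; split=> // x.
  by exists (grid_centre x), 2^-1; rewrite invr_gt0.
set D := (f _)%:num in diamU; pose N := (Num.truncn D).+2.
have DN : D < N.-1%:R.
  have D0 : 0 <= D by rewrite /D.
  by case/andP: (Num.Theory.truncn_itv D0).
have [k [U kU]] : exists (k : G -> 'I_m.+1) (U : G -> set G),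
    forall x, UU (k x) (U x) /\ U x x.
  have /choice[k /choice[U kU]] (x : G) : exists i V, UU i V /\ V x.
    have : [set: G] x by [].
    by rewrite -cov => -[i _ [V UV Vx]]; exists i, V.
  by exists k, U.
have same x y : k x = k y -> near gt n.+1 x y -> U x = U y.
  rewrite -gE => kxy xy; apply: contrapT => ne.
  have [Ux xx] := kU x; have [Uy yy] := kU y; rewrite -kxy in Uy.
  have /lt_le_trans := disj _ _ _ Ux Uy ne.
  move=> /(_ (n.+1%:R%:E)); rewrite ltxx => h; suff : false by []; apply: h.
  apply: le_trans (gdist_le R xy); apply: ereal_inf_lbound.
  by exists (x, y).
have width x z (a : 'I_n) : U x z -> (z a <= x a + N.-2)%N.
  move=> xz; apply: near_grid_coord; rewrite -gE; apply: contrapT => nzx.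
  have := gdist_ge R nzx; apply/negP; rewrite -ltNge.
  apply: le_lt_trans (_ : (D%:E < _)%E); last by rewrite lte_fin.
  apply: le_trans (diamU _ _ (kU x).1); apply: ereal_sup_ubound.
  by exists (z, x) => //; split=> //=; case: (kU x).
pose high x a := exists2 z, U x z & z a = N.-1.
pose cube (x : nat -> nat) (y : lattice n) := forall i : 'I_n, (x i <= y i <= (x i).+1)%N.
(* The value is 1 next to cubes of colour [a] whose cover set reaches the layer [N.-1]. By [width]
   no such set contains a cube at the face 0. *)
pose g (a : 'I_n) (p : lattice n) : 'F_2 :=
  if `[< p a = N \/ exists q, [/\ cube q p, k q = a :> nat & high q a] >]
  then 1 else 0.
have [|a x xa|a x xa|x0 [xN xP]] := @poincare_miranda n N g.
- by [].
- rewrite /g asboolF // => -[|[q [qx _ [z /width zq zN]]]]; first by rewrite xa.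
  have := zq a; have := qx a; rewrite xa zN leqn0 /N /= => /andP[/eqP -> _].
  by rewrite add0n ltnn.
- by rewrite /g asboolT //; left.
have [x xE] : exists x : nat -> nat, forall i : 'I_n, x i = x0 i.
  by exists (fun j => oapp x0 0%N (insub j)) => i; rewrite valK.
have kn : (k x < n)%N by apply: leq_trans (ltn_ord _) mn.
pose a := Ordinal kn.
(* On the cube [x], of colour [a], the value of [g a] only depends on [high x a]: a cube of the same
   colour sharing a corner has the same cover set, and if a corner lies on the face [N], then [x]
   itself is in the layer [N.-1]. *)
have [y xy0] := xP a (if `[< high x a >] then 1 else 0); apply.
have xy : cube x y by move=> i; rewrite xE.
rewrite /g; have [hx|nhx] := pselect (high x a).
  by rewrite asboolT ?(asboolT hx) //; right; exists x.
rewrite asboolF ?(asboolF nhx) // => -[yN|[q [qy kq hq]]]; apply: nhx.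
  exists x; first by case: (kU x).
  by have := xy a; have := xN a; rewrite -xE yN; clear; lia.
rewrite /high -(@same q x) //; first exact: ord_inj.
apply: near_cube => i; have := qy i; have := xy i; clear; lia.
Qed.

End Grid.

Theorem corollary1p8 (R : realType) (n : nat) (hn : (2 <= n)%N) :
  (n%:R%:E <= asdim R (sphere_graphs R n) <= n.+1%:R%:E)%E.
Proof.
apply/andP; split.
  apply: le_ereal_inf_tmp => _ [m mP <-].
  by rewrite lee_fin ler_nat; apply: (asdim_lower hn mP).
by apply: ereal_inf_lbound; exists n.+1 => //; apply: asdim_upper.
Qed.
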